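(* Let $n\ge1$, $T>0$, let $\Omega'\subset\mathbb{R}^{n+1}$ be bounded, open and connected, $\Omega=\Omega'\cap([0,T]\times\mathbb{R}^n)$, with time sections $\Omega_t=\{x:(t,x)\in\Omega\}$ nonempty, bounded and connected for $t\in[0,T]$. Let $\gamma\in\mathcal{C}^{1,2}([0,T]\times\mathbb{R}^n,S(0,1))$ and $\rho\in(0,1)$ with $\bigcup_{0\le\zeta\le\rho}B(x-\zeta\gamma(t,x),\zeta\rho)\subset\Omega_t^c$ for all $x\in\partial\Omega_t$, $t\in[0,T]$, and assume $d(\cdot,x)\in\mathcal{H}^1([0,T],[0,\infty))$ for all $x$, where $d(t,x)=\operatorname{dist}(x,\Omega_t)$. Let $\psi\in\mathcal{C}([0,T],\mathbb{R}^n)$ with $\psi(0)\in\overline\Omega_0$. Then there exists a solution $(\phi,\lambda)$ to the Skorohod problem for $(\Omega,\gamma,\psi)$.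
   Context: For $\eta$ of bounded variation, $|\eta|(t)$ is its total variation on $[0,t]$. A pair $(\phi,\lambda)\in\mathcal{C}([0,T],\mathbb{R}^n)^2$ solves the Skorohod problem for $(\Omega,\gamma,\psi)$ if for all $t\in[0,T]$: $\phi(t)=\psi(t)+\lambda(t)$, $\phi(0)=\psi(0)$; $\phi(t)\in\overline\Omega_t$; $|\lambda|(T)<\infty$; $|\lambda|(t)=\int_{(0,t]}I_{\{\phi(s)\in\partial\Omega_s\}}d|\lambda|(s)$; and $\lambda(t)=\int_{(0,t]}\hat\gamma(s)d|\lambda|(s)$ for some measurable $\hat\gamma:[0,T]\to\mathbb{R}^n$ with $\hat\gamma(s)=\gamma(s,\phi(s))$ $d|\lambda|$-a.e. *)

(* Defs.v *)
From mathcomp Require Import all_boot all_order all_algebra.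
From mathcomp Require Import all_classical all_reals all_analysis.
Import numFieldNormedType.Exports.
Import Order.TTheory GRing.Theory Num.Theory.

Set Implicit Arguments.
Unset Strict Implicit.
Unset Printing Implicit Defensive.

Local Open Scope classical_set_scope.
Local Open Scope ring_scope.

Section Defs.
Context {R : realType} {n : nat}.
Local Notation V := 'rV[R]_n.

(* Euclidean norm on R^n (the library norm on 'rV is the max norm). *)
Definition enorm (x : V) : R := Num.sqrt (\sum_(i < n) x 0 i ^+ 2).

Definition eball (y : V) (r : R) : set V := [set z | enorm (z - y) < r].

Definition boundary (A : set V) : set V := closure A `\` interior A.

Definition tsection (Om : set (R * V)) (t : R) : set V := [set x | Om (t, x)].

Definition dist_to_set (A : set V) (x : V) : R := inf [set enorm (x - y) | y in A].

Definition H1_nonneg (T : R) (f : R -> R) : Prop :=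
  (forall t, 0 <= t <= T -> 0 <= f t) /\
  exists g : R -> R,
    (@lebesgue_measure R).-integrable `[0%R, T] (fun s => (g s)%:E) /\
    (@lebesgue_measure R).-integrable `[0%R, T] (fun s => (g s ^+ 2)%:E) /\
    (forall t, 0 <= t <= T ->
       (f t)%:E = ((f 0)%:E + \int[@lebesgue_measure R]_(s in `[0%R, t]) (g s)%:E)%E).

(* gamma in C^{1,2}([0,T] x R^n, R^n): gamma, d_t gamma, d_{x_i} gamma and
   d_{x_i x_j} gamma exist and are continuous on [0,T] x R^n (the time
   derivative is taken in the open interval and extends continuously to
   the closed one). *)
Definition C12 (T : R) (gam : R -> V -> V) : Prop :=
  let D := `[0%R, T] `*` [set: V] in
  exists (Dt : R -> V -> V) (Dx : 'I_n -> R -> V -> V)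
         (Dxx : 'I_n -> 'I_n -> R -> V -> V),
    {within D, continuous (fun p : R * V => gam p.1 p.2)} /\
    {within D, continuous (fun p : R * V => Dt p.1 p.2)} /\
    (forall i, {within D, continuous (fun p : R * V => Dx i p.1 p.2)}) /\
    (forall i j, {within D, continuous (fun p : R * V => Dxx i j p.1 p.2)}) /\
    (forall t x, 0 < t < T -> is_derive t 1 (fun s => gam s x) (Dt t x)) /\
    (forall t x i, 0 <= t <= T -> is_derive x 'e_i (gam t) (Dx i t x)) /\
    (forall t x i j, 0 <= t <= T -> is_derive x 'e_i (Dx j t) (Dxx i j t x)).

Definition evariation (a b : R) (f : R -> V) (s : seq R) : R :=
  let F := f \o nth b (a :: s) in
  \sum_(0 <= k < size s) enorm (F k.+1 - F k).

Definition eTV (a b : R) (f : R -> V) : \bar R :=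
  ereal_sup [set (evariation a b f s)%:E | s in itv_partition a b].

(* (phi, lam) solves the Skorohod problem for (Omega, gamma, psi) on [0,T].
   The measure d|lam| is represented by a Borel measure mu on R with
   mu(]a,b]) = |lam|(b) - |lam|(a) for 0 <= a <= b <= T, carried by ]0,T]
   (this determines mu uniquely: it is the Lebesgue-Stieltjes measure of |lam|). *)
Definition Skorohod_solution (T : R) (Om : set (R * V)) (gam : R -> V -> V)
    (psi phi lam : R -> V) : Prop :=
  {within `[0%R, T], continuous phi} /\
  {within `[0%R, T], continuous lam} /\
  (forall t, 0 <= t <= T -> phi t = psi t + lam t) /\
  phi 0 = psi 0 /\
  (forall t, 0 <= t <= T -> closure (tsection Om t) (phi t)) /\
  (eTV 0 T lam < +oo)%E /\
  exists mu : {measure set R -> \bar R},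
    (forall a b, 0 <= a -> a <= b -> b <= T ->
       mu `]a, b]%classic = (eTV 0 b lam - eTV 0 a lam)%E) /\
    mu (~` `]0%R, T]%classic) = 0%E /\
    (forall t, 0 <= t <= T ->
       eTV 0 t lam =
       (\int[mu]_(s in `]0%R, t]) ((\1_[set s | boundary (tsection Om s) (phi s)] : R -> R) s)%:E)%E) /\
    exists gh : R -> V,
      (forall i, measurable_fun [set: R] (fun s => gh s 0 i)) /\
      {ae mu, forall s, gh s = gam s (phi s)} /\
      (forall t i, 0 <= t <= T ->
         (lam t 0 i)%:E = (\int[mu]_(s in `]0%R, t]) (gh s 0 i)%:E)%E).

End Defs.

(* Main.v *)
(* Time-discretize: over a short time step move by the increment of psi, then
   push back into the closure of the domain along gamma, by the least amount.
   The exterior cone condition makes this possible with a small push, and also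
   bounds the total push over a short time: if the total push over [t_i, t_j]
   is z and the last push ends at a boundary point x, then, gamma being almost
   constant nearby, the starting point lies well inside the ball
   B(x - z gamma, z rho), which misses Omega_(t_j), whereas it is close to
   Omega_(t_j) because the domain moves continuously in time; hence z is at most
   of the order of the oscillation of psi plus the motion of the domain.
   The discrete paths are thus asymptotically equicontinuous, with bounded total
   push, and have a pointwise limit (lambda, L) along an ultrafilter.  The
   estimate |lambda(b) - lambda(a) - (L(b) - L(a)) gamma(a, phi(a))|
   <= e (L(b) - L(a)) for b - a small passes to the limit; since |gamma| = 1, it
   gives both |lambda| = L and d lambda = gamma dL. *)
From HB Require Import structures.
Require Import Defs.
From mathcomp Require Import all_boot all_order all_algebra.
From mathcomp Require Import all_classical all_reals all_analysis.
From mathcomp Require Import ring lra.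
Import numFieldNormedType.Exports.
Import Order.TTheory GRing.Theory Num.Theory.
Local Open Scope classical_set_scope.
Local Open Scope ring_scope.

(** * Euclidean geometry of row vectors: norm inequalities, neighbourhoods, closures *)

Section EuclideanNorm.
Context {R : realType} {n : nat}.
Implicit Types (x y z : 'rV[R]_n) (A : set 'rV[R]_n).

Lemma enorm_ge0 x : 0 <= enorm x.
Proof. exact: sqrtr_ge0. Qed.

Lemma enorm_sqr x : enorm x ^+ 2 = \sum_(i < n) x 0 i ^+ 2.
Proof. by rewrite sqr_sqrtr// sumr_ge0// => i _; exact: sqr_ge0. Qed.

Lemma enorm0 : enorm (0 : 'rV[R]_n) = 0.
Proof.
by rewrite /enorm big1 ?sqrtr0// => i _; rewrite mxE expr0n.
Qed.

Lemma enormZ a x : enorm (a *: x) = `|a| * enorm x.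
Proof.
rewrite -sqrtr_sqr -sqrtrM ?sqr_ge0//; congr Num.sqrt; rewrite mulr_sumr.
by apply: eq_bigr => i _; rewrite mxE exprMn.
Qed.

Lemma enormN x : enorm (- x) = enorm x.
Proof. by rewrite -scaleN1r enormZ normrN1 mul1r. Qed.

Lemma enormB x y : enorm (x - y) = enorm (y - x).
Proof. by rewrite -enormN opprB. Qed.

Lemma ler_coord_enorm x i : `|x 0 i| <= enorm x.
Proof.
rewrite -sqrtr_sqr ler_wsqrtr// (bigD1 i)//= lerDl sumr_ge0// => j _.
exact: sqr_ge0.
Qed.

Lemma enorm_eq0 x : enorm x = 0 -> x = 0.
Proof.
move=> x0; apply/rowP => i; apply/eqP; rewrite mxE -normr_le0 -x0.
exact: ler_coord_enorm.
Qed.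

(** The squares of [enorm y * x_i - enorm x * y_i] have a nonnegative sum; expanding it and dividing
    by [2 * (enorm x * enorm y)] gives the bound. Zero vectors are set apart because of this
    division. *)
Lemma cauchy_schwarz x y : \sum_(i < n) x 0 i * y 0 i <= enorm x * enorm y.
Proof.
have [x0|/eqP x0] := eqVneq (enorm x) 0.
  by rewrite x0 mul0r big1// => i _; rewrite (enorm_eq0 _ x0) mxE mul0r.
have [y0|/eqP y0] := eqVneq (enorm y) 0.
  by rewrite y0 mulr0 big1// => i _; rewrite (enorm_eq0 _ y0) mxE mulr0.
have xp : 0 < enorm x by rewrite lt_neqAle enorm_ge0 andbT eq_sym; apply/eqP.
have yp : 0 < enorm y by rewrite lt_neqAle enorm_ge0 andbT eq_sym; apply/eqP.
have : 0 <= \sum_(i < n) (enorm y * x 0 i - enorm x * y 0 i) ^+ 2.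
  by rewrite sumr_ge0// => i _; exact: sqr_ge0.
have -> : \sum_(i < n) (enorm y * x 0 i - enorm x * y 0 i) ^+ 2 =
    enorm y ^+ 2 * (\sum_(i < n) x 0 i ^+ 2)
    + enorm x ^+ 2 * (\sum_(i < n) y 0 i ^+ 2)
    - 2 * (enorm x * enorm y) * \sum_(i < n) x 0 i * y 0 i.
  rewrite !mulr_sumr -big_split -sumrB/=.
  by apply: eq_bigr => i _; ring.
rewrite -!enorm_sqr.
move=> h.
have p : 0 < 2 * (enorm x * enorm y) by rewrite !mulr_gt0.
rewrite -(ler_pM2l p); move: h; set s := \sum_(i < n) _; nra.
Qed.

Lemma ler_enormD x y : enorm (x + y) <= enorm x + enorm y.
Proof.
rewrite -(@ler_pXn2r _ 2)// ?nnegrE ?addr_ge0 ?enorm_ge0//.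
rewrite sqrrD !enorm_sqr.
have -> : \sum_(i < n) (x + y) 0 i ^+ 2 = \sum_(i < n) x 0 i ^+ 2
    + (\sum_(i < n) x 0 i * y 0 i) *+ 2 + \sum_(i < n) y 0 i ^+ 2.
  rewrite -sumrMnl -!big_split/=; apply: eq_bigr => i _.
  by rewrite mxE sqrrD.
by rewrite lerD2r lerD2l lerMn2r/= cauchy_schwarz.
Qed.

Lemma ler_enorm_dist y x z : enorm (x - z) <= enorm (x - y) + enorm (y - z).
Proof. by rewrite (le_trans _ (ler_enormD _ _))// addrA subrK. Qed.

Lemma ler_enorm_sum (I : Type) (r : seq I) (P : pred I) (F : I -> 'rV[R]_n) :
  enorm (\sum_(i <- r | P i) F i) <= \sum_(i <- r | P i) enorm (F i).
Proof.
elim/big_rec2: _ => [|i a b _ h]; first by rewrite enorm0.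
by rewrite (le_trans (ler_enormD _ _))// lerD2l.
Qed.

Lemma ler_norm_enorm x : `|x| <= enorm x.
Proof.
rewrite /Num.norm/= mx_normrE; apply/bigmax_leP; split; first exact: enorm_ge0.
by move=> [i j] _ /=; rewrite ord1; exact: ler_coord_enorm.
Qed.

(** The crude factor [n], in place of its square root, suffices for the equivalence of the two
    norms. *)
Lemma ler_enorm_norm x : enorm x <= n%:R * `|x|.
Proof.
rewrite -(@ler_pXn2r _ 2)// ?nnegrE ?mulr_ge0 ?enorm_ge0// enorm_sqr.
apply: (@le_trans _ _ (\sum_(i < n) `|x| ^+ 2)).
  apply: ler_sum => i _; rewrite -real_normK ?num_real//.
  rewrite ler_pXn2r ?nnegrE//.
  by rewrite {2}/Num.norm/= mx_normrE (le_trans _ (le_bigmax _ _ (0, i))).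
rewrite sumr_const card_ord exprMn -[leLHS]mulr_natl ler_wpM2r ?sqr_ge0//.
by rewrite -natrX ler_nat; case: (n) => // m; rewrite expnS leq_pmulr.
Qed.

Lemma nbhs_enormP x A :
  nbhs x A <-> exists2 r, 0 < r & forall y, enorm (y - x) < r -> A y.
Proof.
split.
  move=> /nbhs_ballP[r /= r0 h]; exists r => // y yx.
  apply: h; rewrite -ball_normE/= distrC.
  exact: le_lt_trans (ler_norm_enorm _) yx.
(* Dividing by [n.+1] rather than [n] keeps the radius positive also for [n = 0]. *)
move=> [r r0 h]; apply/nbhs_ballP; exists (r / n.+1%:R) => /=.
  by rewrite divr_gt0.
move=> y; rewrite -ball_normE/= distrC ltr_pdivlMr// => yx; apply: h.
apply: le_lt_trans yx; rewrite (le_trans (ler_enorm_norm _))// mulrC.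
by rewrite ler_wpM2l// ler_nat.
Qed.

Lemma open_enormP A : open A ->
  forall x, A x -> exists2 r, 0 < r & forall y, enorm (y - x) < r -> A y.
Proof. by rewrite openE => oA x /oA; rewrite /interior => /nbhs_enormP. Qed.

Lemma closure_enormP A x :
  closure A x <-> forall e, 0 < e -> exists2 y, A y & enorm (x - y) < e.
Proof.
split=> [clA e e0|h B /nbhs_enormP[r r0 rB]].
  have /clA[y [Ay /= xy]] : nbhs x [set y | enorm (x - y) < e].
    by apply/nbhs_enormP; exists e => // y; rewrite enormB.
  by exists y.
have [y Ay xy] := h _ r0; exists y; split=> //.
by apply: rB; rewrite enormB.
Qed.

Lemma boundaryP A x : open A -> boundary A x <-> closure A x /\ ~ A x.
Proof. by move=> oA; rewrite /boundary (interior_id A).1. Qed.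

(** [m] is the infimum of the admissible coefficients, attained because [A] is closed. This yields
    both the least push into a closure and, with [A] the complement of an open set, the first exit
    from that set. *)
Lemma closed_ray_min A x v c : closed A -> 0 <= c -> A (x + c *: v) ->
  exists m, [/\ 0 <= m <= c, A (x + m *: v) &
    forall r, 0 <= r < m -> ~ A (x + r *: v)].
Proof.
move=> clA c0 Ac; pose E := [set r | 0 <= r /\ A (x + r *: v)].
have E0 : lbound E 0 by move=> r [].
have Ec : E c by [].
have hE : has_inf E by split; [exists c|exists 0].
have m0 : 0 <= inf E by apply: lb_le_inf => //; exists c.
have Em : A (x + inf E *: v).
  apply: clA; apply/closure_enormP => e e0.
  (* Adding 1 keeps the divisor positive when [v = 0]. *)
  have d0 : 0 < e / (enorm v + 1) by rewrite divr_gt0// ltr_wpDl// enorm_ge0.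
  have [r Er] := inf_adherent d0 hE.
  have rm : inf E <= r by apply: ge_inf => //; exists 0.
  move=> rlt; exists (x + r *: v); first by case: Er.
  rewrite opprD addrACA subrr add0r -scalerBl enormZ distrC.
  rewrite ger0_norm ?subr_ge0//.
  have : r - inf E < e / (enorm v + 1) by lra.
  rewrite ltr_pdivlMr ?ltr_wpDl// ?enorm_ge0// => /(le_lt_trans _); apply.
  by rewrite ler_wpM2l ?subr_ge0// lerDl.
exists (inf E); split=> //.
  by rewrite m0/=; apply: ge_inf => //; exists 0.
move=> r /andP[r0 rm] Ar; have : inf E <= r by apply: ge_inf => //; exists 0.
lra.
Qed.

End EuclideanNorm.

(** * Limits along ultrafilters, and approach along a ray *)

Lemma fmap_ultra {I J : Type} (u : I -> J) (F : set_system I) :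
  UltraFilter F -> UltraFilter (fmap u F).
Proof.
move=> FU; have FP := @ultra_proper _ _ FU.
split=> [|G GP sFG]; first exact: fmap_proper_filter.
apply/seteqP; split=> // A GA.
have [//|FA] := in_ultra_setVsetC (u @^-1` A) FU.
have GA' : G (~` A) by apply: sFG.
by have /filter_ex[x []] : G (A `&` ~` A) by exact: filterI.
Qed.

(** A single ultrafilter finer than the tails makes the sequences at all indices converge at once; a
    subsequence need not do so when there are uncountably many indices. *)
Lemma pointwise_ultra_limit {I : Type} {W : topologicalType} (K : set W)
    (u : nat -> I -> W) : compact K -> (forall m i, K (u m i)) ->
  exists (F : set_system nat) (l : I -> W), [/\ ProperFilter F,
    \oo `<=` F & forall i, u ^~ i @ F --> l i].
Proof.
rewrite compact_ultra => cK uK.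
have [F [FU ooF]] := ultraFilterLemma (F := \oo) _.
have FP := @ultra_proper _ _ FU.
have /choice[l lP] : forall i, exists x : W, u ^~ i @ F --> x.
  move=> i; have [|x [_ ux]] := cK _ (fmap_ultra (u ^~ i) _ FU).
    by have : F (u ^~ i @^-1` K) by apply: filterE => m; exact: uK.
  by exists x.
by exists F, l.
Qed.

(** Together with the minimality in [closed_ray_min], this places a first hitting point with [m > 0]
    on the boundary. *)
Lemma ray_approach {R : realType} {n : nat} (x v : 'rV[R]_n) m e :
  0 < m -> 0 < e ->
  exists2 r, 0 <= r < m & enorm ((x + r *: v) - (x + m *: v)) < e.
Proof.
move=> m0 e0; have v1 : 0 < enorm v + 1 by rewrite ltr_wpDl// enorm_ge0.
pose c := Num.min m (e / (enorm v + 1)).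
have c0 : 0 < c by rewrite lt_min m0 divr_gt0.
have cm : c <= m by rewrite ge_min lexx.
have ce : c <= e / (enorm v + 1) by rewrite ge_min lexx orbT.
exists (m - c / 2); first by apply/andP; split; lra.
rewrite opprD addrACA subrr add0r -scalerBl enormZ.
have -> : m - c / 2 - m = - (c / 2) by ring.
rewrite normrN gtr0_norm ?divr_gt0//.
have : c / 2 < e / (enorm v + 1) by lra.
rewrite ltr_pdivlMr// => /(le_lt_trans _); apply.
by rewrite ler_wpM2l ?lerDl// ltW// divr_gt0.
Qed.

Local Ltac vring := by apply/rowP => ?; rewrite !mxE; ring.

(** * The discrete scheme: one oblique step, then its iteration *)

Section Reflection.
Context {R : realType} {n : nat}.
Local Notation V := 'rV[R]_n.
Variables (T rho M : R) (S : R -> set V) (gam : R -> V -> V) (psi : R -> V).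
Hypothesis T_gt0 : 0 < T.
Hypothesis rho_gt0 : 0 < rho.
Hypothesis rho_le1 : rho <= 1.
Hypothesis open_S : forall t : R, 0 <= t <= T -> open (S t).
Hypothesis bounded_S :
  forall (t : R) (x : V), 0 <= t <= T -> closure (S t) x -> enorm x <= M.
Hypothesis enorm_gam : forall (t : R) (x : V), 0 <= t <= T -> enorm (gam t x) = 1.
Hypothesis exterior_cone : forall (t : R) (x : V), 0 <= t <= T ->
  closure (S t) x -> ~ S t x -> forall z : R, 0 <= z <= rho ->
  forall y, enorm (y - (x - z *: gam t x)) < z * rho -> ~ S t y.
Hypothesis S_unif : forall e : R, 0 < e -> exists2 d : R, 0 < d &
  forall (s t : R) (x : V), 0 <= s <= T -> 0 <= t <= T -> `|s - t| <= d ->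
  closure (S s) x -> exists2 y, S t y & enorm (x - y) < e.
Hypothesis gam_unif : forall e : R, 0 < e -> exists2 d : R, 0 < d &
  forall (s t : R) (x y : V), 0 <= s <= T -> 0 <= t <= T ->
  enorm x <= M -> enorm y <= M -> `|s - t| <= d -> enorm (x - y) <= d ->
  enorm (gam s x - gam t y) <= e.
Hypothesis psi_unif : forall e : R, 0 < e -> exists2 d : R, 0 < d &
  forall s t : R, 0 <= s <= T -> 0 <= t <= T -> `|s - t| <= d ->
  enorm (psi s - psi t) <= e.
Hypothesis psi_0 : closure (S 0) (psi 0).

(** A push of fixed length [l0] lands in [S t]: otherwise the segment from a point [y] of [S t] near
    [x] to the pushed point first leaves [S t] at some [w], and the exterior cone at [w] contains
    [y]. The push chosen is the least one that reaches the closure. *)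
Lemma oblique_step (e : R) : 0 < e -> exists2 d : R, 0 < d &
  forall (s t : R) (x : V), 0 <= s <= T -> 0 <= t <= T -> `|s - t| <= d ->
  closure (S s) x ->
  exists2 l, 0 <= l <= e & let z := x + (psi t - psi s) + l *: gam s x in
    closure (S t) z /\ (0 < l -> ~ S t z).
Proof.
move=> e0; have [|dg dg0 dgP] := gam_unif (rho / 2); first by rewrite divr_gt0.
pose m := Num.min e (Num.min rho dg).
have m0 : 0 < m by rewrite !lt_min e0 rho_gt0.
have me : m <= e by rewrite ge_min lexx.
have mr : m <= rho by rewrite !ge_min lexx orbT.
have mg : m <= dg by rewrite !ge_min lexx !orbT.
(* [eta] is half of [l0 * rho]: the radius of the cone is shared equally between the displacement
   [x - y + p] and the variation of [gam]. *)
pose eta := m * rho / 4; pose l0 := m / 2.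
have l00 : 0 < l0 by rewrite divr_gt0.
have eta0 : 0 < eta by rewrite divr_gt0// mulr_gt0.
have etal : eta = l0 * rho / 2 by rewrite /eta /l0; field.
have etam : eta <= m / 4 by rewrite /eta ler_pM2r ?invr_gt0// ler_piMr// ltW.
have [|dp dp0 dpP] := psi_unif (eta / 2); first by rewrite divr_gt0.
have [|dm dm0 dmP] := S_unif (eta / 2); first by rewrite divr_gt0.
exists (Num.min dg (Num.min dp dm)); first by rewrite !lt_min dg0 dp0.
move=> s t x sT tT; rewrite !le_min => /and3P[stg stp stm] xS.
have [y yS xy] := dmP s t x sT tT stm xS.
set p := psi t - psi s; have ple : enorm p <= eta / 2.
  by rewrite /p enormB dpP.
set g := gam s x; have g1 : enorm g = 1 by rewrite /g enorm_gam.
have xpy : enorm (x - y + p) < eta.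
  by rewrite (le_lt_trans (ler_enormD _ _))//; lra.
pose v := x + p + l0 *: g - y.
have vE : v = (x - y + p) + l0 *: g by rewrite /v; vring.
have vle : enorm v <= eta + l0.
  rewrite vE (le_trans (ler_enormD _ _))//; apply: lerD; first exact: ltW.
  by rewrite enormZ g1 mulr1 gtr0_norm.
have Sz : S t (x + p + l0 *: g).
  apply: contrapT => Nz.
  have [|||a [/andP[a0 a1] Na aP]] := @closed_ray_min _ _ (~` S t) y v 1.
  - by apply: open_closedC; exact: open_S.
  - exact: ler01.
  - by rewrite scale1r /v addrC subrK.
  have {}a0 : 0 < a.
    rewrite lt_neqAle a0 andbT; apply/eqP => a00; apply: Na.
    by rewrite -a00 scale0r addr0.
  pose w := y + a *: v.
  have clw : closure (S t) w.
    apply/closure_enormP => r r0.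
    have [b /aP b01 bw] := ray_approach y v _ _ a0 r0.
    by exists (y + b *: v); [exact: contrapT|rewrite enormB].
  have wx : enorm (w - x) <= dg.
    rewrite /w addrAC (le_trans (ler_enormD _ _))// enormB enormZ gtr0_norm//.
    have : a * enorm v <= 1 * enorm v by rewrite ler_wpM2r// enorm_ge0.
    have -> : dg = eta / 2 + (dg - eta / 2) by ring.
    rewrite mul1r => h; apply: lerD; first exact: ltW.
    apply: (le_trans h); apply: (le_trans vle); rewrite /l0; lra.
  have gw : enorm (gam t w - g) <= rho / 2.
    apply: dgP => //; [exact: bounded_S clw|exact: bounded_S xS|].
    by rewrite distrC.
  (* The height [a * l0] is proportional to the part of the segment already covered, so [a] cancels
     and the estimate holds however small [a] is. *)
  apply: (exterior_cone t w tT clw Na (a * l0)) yS.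
    apply/andP; split; first by rewrite ltW// mulr_gt0.
    apply: (@le_trans _ _ (1 * l0)); first by rewrite ler_wpM2r// ltW.
    rewrite /l0; lra.
  have -> : y - (w - (a * l0) *: gam t w) =
      a *: (l0 *: (gam t w - g) - (x - y + p)).
    rewrite /w vE; move: (x - y + p) => q.
    vring.
  rewrite enormZ gtr0_norm// -mulrA ltr_pM2l//.
  rewrite (le_lt_trans (ler_enormD _ _))// enormN enormZ gtr0_norm//.
  have : l0 * enorm (gam t w - g) <= l0 * (rho / 2) by rewrite ler_wpM2l// ltW.
  move: etal xpy; lra.
have [|||l [/andP[ll ll0] lS lP]] :=
    @closed_ray_min _ _ (closure (S t)) (x + p) g l0.
- exact: closed_closure.
- exact: ltW.
- exact: subset_closure.
exists l; first by rewrite ll/=; move: ll0; rewrite /l0; lra.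
(* If a positive least push ended inside the open set [S t], slightly shorter pushes would already
   reach it. *)
split=> // lp Sl.
have [r r0 rP] := open_enormP _ (open_S t tT) _ Sl.
have [b bl bP] := ray_approach (x + p) g _ _ lp r0.
by apply: (lP _ bl); apply: subset_closure; exact: rP.
Qed.

(* h is the mesh, f the positions and l the lengths of the pushes. *)
Definition euler_path (e h : R) (N : nat) (f : nat -> V) (l : nat -> R) :=
  [/\ f 0%N = psi 0,
    forall k, (k <= N)%N -> closure (S (k%:R * h)) (f k) &
    forall k, (k < N)%N -> [/\ 0 <= l k <= e,
      f k.+1 = f k + (psi (k.+1%:R * h) - psi (k%:R * h))
               + l k *: gam (k%:R * h) (f k) &
      0 < l k -> ~ S (k.+1%:R * h) (f k.+1)]].

Lemma grid_itv (h : R) N k : 0 < h -> N%:R * h = T -> (k <= N)%N ->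
  0 <= k%:R * h <= T.
Proof.
by move=> h0 <- kN; rewrite mulr_ge0 ?ler_wpM2r ?ler_nat// ltW.
Qed.

(** Choice turns the step into a total function of two times and a position, so the path is a plain
    recursion; that it stays in the closures follows by induction. *)
Lemma euler_path_exists (e : R) : 0 < e -> exists2 d : R, 0 < d &
  forall (h : R) N, 0 < h <= d -> N%:R * h = T -> exists f l, euler_path e h N f l.
Proof.
move=> e0; have [d d0 dP] := oblique_step _ e0; exists d => //.
move=> h N /andP[h0 hd] NhT.
have [l lP] : exists l : R -> R -> V -> R, forall s t x,
    0 <= s <= T -> 0 <= t <= T -> `|s - t| <= d -> closure (S s) x ->
    0 <= l s t x <= e /\ let z := x + (psi t - psi s) + l s t x *: gam s x in
    closure (S t) z /\ (0 < l s t x -> ~ S t z).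
  have : forall q : R * R * V, exists r,
      0 <= q.1.1 <= T -> 0 <= q.1.2 <= T -> `|q.1.1 - q.1.2| <= d ->
      closure (S q.1.1) q.2 ->
      0 <= r <= e /\
      let z := q.2 + (psi q.1.2 - psi q.1.1) + r *: gam q.1.1 q.2 in
      closure (S q.1.2) z /\ (0 < r -> ~ S q.1.2 z).
    move=> [[s t] x] /=.
    case: (pselect [/\ 0 <= s <= T, 0 <= t <= T, `|s - t| <= d & closure (S s) x]).
      by move=> [s1 t1 st xS]; have [r re rP] := dP _ _ _ s1 t1 st xS; exists r.
    (* Inadmissible triples receive the default push 0. *)
    by move=> Nst; exists 0 => *; exfalso; exact: Nst.
  by move=> /choice[l lP]; exists (fun s t x => l (s, t, x)) => s t x; exact: lP (s, t, x).
pose t k : R := k%:R * h.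
pose f := fix F k := if k is k'.+1 then
  F k' + (psi (t k'.+1) - psi (t k')) + l (t k') (t k'.+1) (F k') *: gam (t k') (F k')
  else psi 0.
have tS k : `|t k - t k.+1| <= d.
  rewrite /t -mulrBl -natr1 opprD addrA subrr add0r mulN1r normrN gtr0_norm//.
have fS k : (k <= N)%N -> closure (S (t k)) (f k).
  elim: k => [_|k ih kN]; first by rewrite /t mul0r.
  have [||_ [clf _]] := lP (t k) (t k.+1) (f k) _ _ (tS k) (ih (ltnW kN)).
  - exact: (grid_itv _ _ _ h0 NhT (ltnW kN)).
  - exact: (grid_itv _ _ _ h0 NhT kN).
  exact: clf.
exists f, (fun k => l (t k) (t k.+1) (f k)); split=> // k kN.
have [||le [_ Nf]] := lP (t k) (t k.+1) (f k) _ _ (tS k) (fS _ (ltnW kN)).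
- exact: (grid_itv _ _ _ h0 NhT (ltnW kN)).
- exact: (grid_itv _ _ _ h0 NhT kN).
by split.
Qed.

(** * Estimates along a discrete path *)

Section EulerPath.
Variables (e h : R) (N : nat) (f : nat -> V) (l : nat -> R).
Hypothesis h_gt0 : 0 < h.
Hypothesis NhT : N%:R * h = T.
Hypothesis fl : euler_path e h N f l.

Lemma euler_path_telescope i j : (i <= j <= N)%N ->
  f j - f i = psi (j%:R * h) - psi (i%:R * h)
    + \sum_(i <= k < j) l k *: gam (k%:R * h) (f k).
Proof.
case: fl => f0 fS fl'.
elim: j => [|j ih].
  by rewrite leqn0 => /andP[/eqP-> _]; rewrite !subrr big_geq// addr0.
move=> /andP[]; rewrite leq_eqVlt => /predU1P[-> _|ij jN].
  by rewrite !subrr big_geq// addr0.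
have [_ -> _] := fl' _ jN.
rewrite big_nat_recr//= [RHS]addrA.
have := ih; rewrite -ltnS ij ltnW// => /(_ isT) ihj.
rewrite -[psi (j.+1%:R * h)](subrK (psi (j%:R * h))).
set u := psi (j.+1%:R * h) - _.
rewrite -[RHS]addrA addrC -[LHS]addrA.
have -> : f j = f i + (psi (j%:R * h) - psi (i%:R * h) +
   \sum_(i <= k < j) l k *: gam (k%:R * h) (f k)) by rewrite -ihj addrC subrK.
vring.
Qed.

Lemma euler_push_ge0 i j : (j <= N)%N -> 0 <= \sum_(i <= k < j) l k.
Proof.
case: fl => _ _ fl' jN; rewrite big_nat sumr_ge0// => k /andP[_ kj].
by have [/andP[]] := fl' _ (leq_trans kj jN).
Qed.

(** The pushes are nonnegative weights, so a uniform error in the directions costs at most that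
    error times the total push. Taking [g = 0] and [c = 1] bounds the constraint term itself. *)
Lemma euler_push_dist i j (g : V) c : (j <= N)%N ->
  (forall k, (i <= k < j)%N -> enorm (gam (k%:R * h) (f k) - g) <= c) ->
  enorm (\sum_(i <= k < j) l k *: gam (k%:R * h) (f k)
         - (\sum_(i <= k < j) l k) *: g) <= c * \sum_(i <= k < j) l k.
Proof.
case: fl => _ _ fl' jN hg.
rewrite scaler_suml -sumrB (le_trans (ler_enorm_sum _ _ _ _))//.
rewrite mulr_sumr big_nat [leRHS]big_nat ler_sum// => k kij.
have [|/andP[lk _] _ _] := fl' k; first by case/andP: kij => _ /leq_trans; exact.
by rewrite -scalerBr enormZ ger0_norm// mulrC ler_wpM2r// hg.
Qed.

Lemma euler_push_enorm i j : (j <= N)%N ->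
  enorm (\sum_(i <= k < j) l k *: gam (k%:R * h) (f k)) <= \sum_(i <= k < j) l k.
Proof.
move=> jN; have := @euler_push_dist i j 0 1 jN.
rewrite scaler0 subr0 mul1r; apply => k /andP[_ kj].
by rewrite subr0 enorm_gam//; apply: (grid_itv _ _ _ h_gt0 NhT); rewrite ltnW// (leq_trans kj).
Qed.

Lemma euler_path_enorm k : (k <= N)%N -> enorm (f k) <= M.
Proof.
case: fl => _ fS _ kN; apply: bounded_S (fS _ kN); exact: (grid_itv _ _ _ h_gt0 NhT).
Qed.

Lemma euler_path_dist i j : (i <= j <= N)%N ->
  enorm (f j - f i) <= enorm (psi (j%:R * h) - psi (i%:R * h))
    + \sum_(i <= k < j) l k.
Proof.
move=> ij; rewrite (euler_path_telescope _ _ ij) (le_trans (ler_enormD _ _))//.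
by rewrite lerD2l euler_push_enorm//; case/andP: ij.
Qed.

End EulerPath.

Lemma grid_dist (h : R) i j k m : 0 < h -> (i <= k <= j)%N -> (i <= m <= j)%N ->
  `|k%:R * h - m%:R * h| <= j%:R * h - i%:R * h.
Proof.
move=> h0 /andP[ik kj] /andP[im mj].
have H a b : (a <= b)%N -> a%:R * h <= b%:R * h.
  by move=> ab; rewrite ler_wpM2r ?ler_nat// ltW.
have := H _ _ ik; have := H _ _ kj; have := H _ _ im; have := H _ _ mj.
move: (k%:R * h) (m%:R * h) (i%:R * h) (j%:R * h) => a b c d *.
rewrite ler_norml; apply/andP; split; lra.
Qed.

(** Bootstrap on [j]: the bound [B] on the shorter window and one more push give a total of at most
    [2 * B]. This keeps the height of the cone below [rho] and [gam] within [rho / 2] of its final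
    value, and the cone condition then improves the bound back to [B]. *)
Lemma euler_push_small (A : R) : 0 < A -> exists2 d : R, 0 < d &
  forall (e h : R) N f l, e <= d -> 0 < h -> N%:R * h = T -> euler_path e h N f l ->
  forall i j, (i <= j <= N)%N -> j%:R * h - i%:R * h <= d ->
  \sum_(i <= k < j) l k <= A.
Proof.
move=> A0; have [|dg dg0 dgP] := gam_unif (rho / 2); first by rewrite divr_gt0.
(* [rho / 2] ensures [2 * B <= rho], and [dg / 3] ensures [b + 2 * B <= dg]. *)
pose B := Num.min A (Num.min (rho / 2) (dg / 3)).
have B0 : 0 < B by rewrite !lt_min A0 !divr_gt0.
have BA : B <= A by rewrite ge_min lexx.
have Br : B <= rho / 2 by rewrite !ge_min lexx orbT.
have Bg : B <= dg / 3 by rewrite !ge_min lexx !orbT.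
clearbody B.
(* The increment of [psi] and the motion of the domain cost [b] each, together [rho * B / 2]; the
   variation of [gam] uses the other half of the radius [rho * Z]. *)
pose b := rho * B / 4.
have b0 : 0 < b by rewrite divr_gt0// mulr_gt0.
have bB : b <= B.
  have : rho * B <= 1 * B by rewrite ler_wpM2r// ltW.
  rewrite /b; lra.
have [dp dp0 dpP] := psi_unif _ b0.
have [dm dm0 dmP] := S_unif _ b0.
exists (Num.min B (Num.min dg (Num.min dp dm))).
  by rewrite !lt_min B0 dg0 dp0.
move=> e h N f l; rewrite le_min => /andP[eB _] h0 NhT fl i j ij jid.
apply: le_trans BA; elim: j ij jid => [|j ih].
  by move=> _ _; rewrite big_geq// ltW.
move=> /andP[]; rewrite leq_eqVlt => /predU1P[-> _ _|ij jN].
  by rewrite big_geq// ltW.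
move=> jid; move: (jid); rewrite !le_min => /and4P[jiB jig jip jim].
have jmono : j%:R * h <= j.+1%:R * h by rewrite ler_wpM2r ?ler_nat// ltW.
have {ih} : \sum_(i <= k < j) l k <= B.
  apply: ih; first by rewrite -ltnS ij ltnW.
  by apply: le_trans jid; rewrite lerD2r.
case: (fl) => f0 fS /(_ _ jN)[/andP[lj0 lje] fj Nfj] ih.
rewrite big_nat_recr//=.
(* Without a last push the earlier bound persists; with one, [f j.+1] is a boundary point and
   carries an exterior cone. *)
have [lj|lj] := leP (l j) 0; first by apply: le_trans ih; rewrite gerDl.
have {Nfj}Nfj := Nfj lj.
set Z := _ + _; have ZE : Z = \sum_(i <= k < j.+1) l k by rewrite big_nat_recr.
have Z2 : Z <= 2 * B by rewrite /Z; lra.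
have jT := grid_itv _ _ _ h0 NhT jN.
have iN : (i <= N)%N by rewrite ltnW// (leq_trans ij).
have iT := grid_itv _ _ _ h0 NhT iN.
have kgam k : (i <= k < j.+1)%N ->
    enorm (gam (k%:R * h) (f k) - gam (j.+1%:R * h) (f j.+1)) <= rho / 2.
  move=> /andP[ik kj]; have kN : (k <= N)%N by rewrite ltnW// (leq_trans kj).
  have kd : `|k%:R * h - j.+1%:R * h| <= j.+1%:R * h - i%:R * h.
    by apply: grid_dist => //; rewrite ?ik ?leqnn ?andbT//= ltnW.
  apply: dgP; [exact: (grid_itv _ _ _ h0 NhT)|by []|exact: (euler_path_enorm _ _ _ _ _ h0 NhT fl)
    |exact: (euler_path_enorm _ _ _ _ _ h0 NhT fl)|exact: le_trans jig|].
  rewrite enormB.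
  have kjN : (k <= j.+1 <= N)%N by rewrite ltnW.
  apply: (le_trans (euler_path_dist _ _ _ _ _ h0 NhT fl _ _ kjN)).
  have : enorm (psi (j.+1%:R * h) - psi (k%:R * h)) <= b.
    apply: dpP => //; first exact: (grid_itv _ _ _ h0 NhT).
    by rewrite distrC (le_trans kd).
  have : \sum_(k <= m < j.+1) l m <= Z.
    rewrite ZE (big_cat_nat (m := i) (n := k) (p := j.+1))//=; last exact: ltnW.
    by rewrite lerDr (euler_push_ge0 _ _ _ _ _ fl).
  lra.
have tdist : `|i%:R * h - j.+1%:R * h| <= j.+1%:R * h - i%:R * h.
  by apply: grid_dist => //; rewrite ?leqnn ?andbT//= ltnW.
have [y yS fy] := dmP _ _ _ iT jT (le_trans tdist jim) (fS _ iN).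
(* If [Z] exceeded [B], the ball at distance [Z] along the cone at [f j.+1] would contain [y], a
   point of the section near [f i]. *)
apply: contrapT => /negP; rewrite -ltNge => BZ.
apply: (exterior_cone _ _ jT (fS _ jN) Nfj Z) yS.
  by apply/andP; split; lra.
have ijN : (i <= j.+1 <= N)%N by rewrite ltnW.
have := euler_path_telescope _ _ _ _ _ fl _ _ ijN.
have := euler_push_dist _ _ _ _ _ fl i j.+1 (gam (j.+1%:R * h) (f j.+1)) (rho / 2) jN kgam.
rewrite -ZE; set G := gam _ _; set W := \sum_(i <= k < j.+1) _ => WZ tele.
have -> : y - (f j.+1 - Z *: G) = (y - f i)
     - (psi (j.+1%:R * h) - psi (i%:R * h)) - (W - Z *: G).
  have -> : W = (f j.+1 - f i) - (psi (j.+1%:R * h) - psi (i%:R * h)).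
    by rewrite tele addrC addKr.
  vring.
have pb : enorm (psi (j.+1%:R * h) - psi (i%:R * h)) <= b.
  by apply: dpP => //; rewrite distrC (le_trans tdist).
apply: (le_lt_trans (ler_enormD _ _)); rewrite enormN.
apply: (@lt_le_trans _ _ (2 * b + rho / 2 * Z)).
  apply: ltr_leD => //; apply: (le_lt_trans (ler_enormD _ _)); rewrite enormN enormB.
  lra.
have : rho * B <= rho * Z by rewrite ler_wpM2l// ltW.
rewrite /b; lra.
Qed.

(* ph is the position, lam the constraint term and L the total push of an Euler
   path with mesh and pushes at most q, as step functions of time. *)
Definition approx (q : R) (ph lam : R -> V) (L : R -> R) :=
  exists (h : R) N f l, [/\ 0 < h <= q, N%:R * h = T, euler_path q h N f l &
    [/\ forall t, ph t = f (Num.truncn (t / h)),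
      forall t, lam t =
        \sum_(0 <= k < Num.truncn (t / h)) l k *: gam (k%:R * h) (f k) &
      forall t, L t = \sum_(0 <= k < Num.truncn (t / h)) l k]].

(** * Estimates in continuous time for the step functions *)

Lemma grid_index (h : R) N t : 0 < h -> N%:R * h = T -> 0 <= t <= T ->
  let k := Num.truncn (t / h) in
  [/\ (k <= N)%N, k%:R * h <= t & t < k.+1%:R * h].
Proof.
move=> h0 NhT /andP[t0 tT] k.
have th0 : 0 <= t / h by rewrite divr_ge0// ltW.
have /andP[kt tk] := truncn_itv th0.
have kt' : k%:R * h <= t by rewrite -ler_pdivlMr.
split=> //; last by rewrite -ltr_pdivrMr.
by rewrite -(ler_nat R) -(ler_pM2r h0) NhT (le_trans kt').
Qed.

Lemma grid_index_le (h : R) a b : 0 < h -> 0 <= a <= b ->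
  (Num.truncn (a / h) <= Num.truncn (b / h))%N.
Proof.
move=> h0 /andP[a0 ab]; apply: le_truncn.
by rewrite ler_pM2r// invr_gt0.
Qed.

(** The factor 2 accounts for the grid point at or before [a], which may precede [a] by almost a
    full mesh. *)
Lemma grid_index_le_dist (h d : R) N a b k : 0 < h <= d -> N%:R * h = T ->
  0 <= a -> a <= b -> b <= T -> b - a <= d ->
  (Num.truncn (a / h) <= k <= Num.truncn (b / h))%N ->
  `|k%:R * h - a| <= d /\ `|k%:R * h - (Num.truncn (a / h))%:R * h| <= 2 * d.
Proof.
move=> /andP[h0 hd] NhT a0 ab bT bad /andP[ak kb].
have [|_ a1 a2] := grid_index h N a h0 NhT; first by rewrite a0 (le_trans ab).
have [|_ b1 _] := grid_index h N b h0 NhT; first by rewrite (le_trans a0)/=.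
have : (Num.truncn (a / h))%:R * h <= k%:R * h.
  by rewrite ler_wpM2r ?ler_nat// ltW.
have : k%:R * h <= (Num.truncn (b / h))%:R * h.
  by rewrite ler_wpM2r ?ler_nat// ltW.
move: a2; rewrite -natr1 mulrDl mul1r.
move: (k%:R * h) (_%:R * h) (_%:R * h) a1 b1 => x y z *.
rewrite !ler_norml; split; apply/andP; split; lra.
Qed.

Lemma approx_exists (q : R) : 0 < q -> exists ph lam L, approx q ph lam L.
Proof.
move=> q0; have [d d0 dP] := euler_path_exists _ q0.
pose m := Num.min d q; have m0 : 0 < m by rewrite lt_min d0.
(* Rounding [T / m] up makes the mesh [T / N] at most [m] while the grid ends exactly at [T]. *)
pose N := (Num.truncn (T / m)).+1.
have NhT : N%:R * (T / N%:R) = T by rewrite mulrC divfK// pnatr_eq0.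
have h0 : 0 < T / N%:R by rewrite divr_gt0.
have hm : T / N%:R <= m.
  rewrite ler_pdivrMr// mulrC -ler_pdivrMr//.
  have /andP[_ /ltW //] : (Num.truncn (T / m))%:R <= T / m < N%:R.
  by apply: truncn_itv; rewrite divr_ge0// ltW.
have [|f [l fl]] := dP (T / N%:R) N _ NhT.
  by rewrite h0 (le_trans hm)// ge_min lexx.
exists (fun t => f (Num.truncn (t / (T / N%:R)))).
exists (fun t => \sum_(0 <= k < Num.truncn (t / (T / N%:R)))
  l k *: gam (k%:R * (T / N%:R)) (f k)).
exists (fun t => \sum_(0 <= k < Num.truncn (t / (T / N%:R))) l k).
exists (T / N%:R), N, f, l; split=> //.
by rewrite h0 (le_trans hm)// ge_min lexx orbT.
Qed.

Lemma big_nat_sub (W : zmodType) (F : nat -> W) i j : (i <= j)%N ->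
  \sum_(0 <= k < j) F k - \sum_(0 <= k < i) F k = \sum_(i <= k < j) F k.
Proof.
move=> ij; rewrite (big_cat_nat (n := i) (leq0n i) ij)/=.
by apply/eqP; rewrite subr_eq addrC.
Qed.

Lemma approx0 q ph lam L : approx q ph lam L ->
  [/\ ph 0 = psi 0, lam 0 = 0 & L 0 = 0].
Proof.
move=> [h [N [f [l [_ _ [f0 _ _] [phE lamE LE]]]]]].
by rewrite phE lamE LE mul0r truncn0 !big_geq.
Qed.

Lemma approx_le q ph lam L : approx q ph lam L ->
  forall a b, 0 <= a -> a <= b -> b <= T ->
  enorm (lam b - lam a) <= L b - L a.
Proof.
move=> [h [N [f [l [/andP[h0 hq] NhT fl [phE lamE LE]]]]]] a b a0 ab bT.
have kab : (Num.truncn (a / h) <= Num.truncn (b / h))%N.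
  by apply: grid_index_le; rewrite ?a0.
have [|bN _ _] := grid_index h N b h0 NhT; first by rewrite (le_trans a0)/=.
by rewrite !lamE !LE !big_nat_sub// (euler_push_enorm _ _ _ _ _ h0 NhT fl).
Qed.

Lemma approx_enorm q ph lam L : approx q ph lam L ->
  forall t, 0 <= t <= T -> enorm (ph t) <= M.
Proof.
move=> [h [N [f [l [/andP[h0 hq] NhT fl [phE lamE LE]]]]]] t tT.
have [tN _ _] := grid_index h N t h0 NhT tT.
by rewrite phE (euler_path_enorm _ _ _ _ _ h0 NhT fl).
Qed.

Lemma approx_push_small (A : R) : 0 < A -> exists2 d : R, 0 < d &
  forall q ph lam L, q <= d -> approx q ph lam L ->
  forall a b, 0 <= a -> a <= b -> b <= T -> b - a <= d -> L b - L a <= A.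
Proof.
move=> A0; have [d d0 dP] := euler_push_small _ A0.
(* Halved because the grid window that belongs to [[a, b]] may be longer by one mesh. *)
exists (d / 2); first by rewrite divr_gt0.
move=> q ph lam L qd [h [N [f [l [/andP[h0 hq] NhT fl [phE lamE LE]]]]]].
move=> a b a0 ab bT abd.
have kab : (Num.truncn (a / h) <= Num.truncn (b / h))%N.
  by apply: grid_index_le; rewrite ?a0.
have [|bN _ _] := grid_index h N b h0 NhT; first by rewrite (le_trans a0)/=.
rewrite !LE big_nat_sub//; apply: (dP q h N f l) => //; rewrite ?kab//.
  by apply: (le_trans qd); lra.
apply: (le_trans (ler_norm _)).
have [||_] := grid_index_le_dist h (d / 2) N a b (Num.truncn (b / h)) _ NhT a0 ab bT abd.
- by rewrite h0 (le_trans hq).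
- by rewrite kab leqnn.
by move=> /le_trans; apply; lra.
Qed.

(** In a short window the total push and the oscillation of [psi] are small, so the position moves
    little and every push direction stays within [e] of the one at the start. *)
Lemma approx_push_dir (e : R) : 0 < e -> exists2 d : R, 0 < d &
  forall q ph lam L, q <= d -> approx q ph lam L ->
  forall a b, 0 <= a -> a <= b -> b <= T -> b - a <= d ->
  enorm (lam b - lam a - (L b - L a) *: gam a (ph a)) <= e * (L b - L a).
Proof.
move=> e0; have [dg dg0 dgP] := gam_unif _ e0.
have dg2 : 0 < dg / 2 by rewrite divr_gt0.
have [dp dp0 dpP] := psi_unif _ dg2.
have [da da0 daP] := euler_push_small _ dg2.
pose d := Num.min dg (Num.min (dp / 2) (da / 2)).
have d0 : 0 < d by rewrite !lt_min dg0 !divr_gt0.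
have ddg : d <= dg by rewrite ge_min lexx.
have ddp : 2 * d <= dp.
  have : d <= dp / 2 by rewrite !ge_min lexx orbT.
  lra.
have dda : 2 * d <= da.
  have : d <= da / 2 by rewrite !ge_min lexx !orbT.
  lra.
clearbody d; exists d => //.
move=> q ph lam L qd [h [N [f [l [/andP[h0 hq] NhT fl [phE lamE LE]]]]]].
move=> a b a0 ab bT abd.
have kab : (Num.truncn (a / h) <= Num.truncn (b / h))%N.
  by apply: grid_index_le; rewrite ?a0.
have aT : 0 <= a <= T by rewrite a0 (le_trans ab).
have hd : 0 < h <= d by rewrite h0 (le_trans hq).
have [|bN _ _] := grid_index h N b h0 NhT; first by rewrite (le_trans a0)/=.
rewrite !lamE !LE !big_nat_sub// phE.
apply: (euler_push_dist _ _ _ _ _ fl) => // k /andP[ak kb].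
have kN : (k <= N)%N by rewrite ltnW// (leq_trans kb).
have [|kd1 kd2] := grid_index_le_dist h d N a b k hd NhT a0 ab bT abd.
  by rewrite ak ltnW.
have akN : (Num.truncn (a / h) <= k <= N)%N by rewrite ak.
apply: dgP => //; last 2 first.
- exact: le_trans kd1 ddg.
- apply: (le_trans (euler_path_dist _ _ _ _ _ h0 NhT fl _ _ akN)).
  have -> : dg = dg / 2 + dg / 2 by field.
  apply: lerD.
    apply: dpP; [exact: (grid_itv _ _ _ h0 NhT)| |exact: le_trans kd2 ddp].
    by apply: (grid_itv _ _ _ h0 NhT); rewrite (leq_trans ak).
  apply: (daP q h N f l) => //; first lra.
  by apply: (le_trans (ler_norm _)); exact: le_trans kd2 dda.
- exact: (grid_itv _ _ _ h0 NhT).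
- exact: (euler_path_enorm _ _ _ _ _ h0 NhT fl).
- by apply: (euler_path_enorm _ _ _ _ _ h0 NhT fl); rewrite (leq_trans ak).
Qed.

(** At grid times the decomposition is exact; between them only the increment of [psi] since the
    last grid point is missing. *)
Lemma approx_decomposition (e : R) : 0 < e -> exists2 d : R, 0 < d &
  forall q ph lam L, q <= d -> approx q ph lam L ->
  forall t, 0 <= t <= T -> enorm (ph t - (psi t + lam t)) <= e.
Proof.
move=> e0; have [d d0 dP] := psi_unif _ e0; exists d => //.
move=> q ph lam L qd [h [N [f [l [/andP[h0 hq] NhT fl [phE lamE LE]]]]]] t tT.
have [tN t1 t2] := grid_index h N t h0 NhT tT.
rewrite phE lamE; set k := Num.truncn _ in t1 t2 tN *.
have := euler_path_telescope _ _ _ _ _ fl 0%N k tN.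
rewrite mul0r; case: (fl) => -> _ _ fk.
have -> : f k - (psi t + \sum_(0 <= i < k) l i *: gam (i%:R * h) (f i))
    = psi (k%:R * h) - psi t.
  rewrite -[f k](subrK (psi 0)) fk; vring.
apply: dP => //; first exact: (grid_itv _ _ _ h0 NhT).
rewrite ler_norml; move: t2; rewrite -natr1 mulrDl mul1r => t2.
apply/andP; split; lra.
Qed.

Lemma approx_in_domain (e : R) : 0 < e -> exists2 d : R, 0 < d &
  forall q ph lam L, q <= d -> approx q ph lam L ->
  forall t, 0 <= t <= T -> exists2 y, S t y & enorm (ph t - y) < e.
Proof.
move=> e0; have [d d0 dP] := S_unif _ e0; exists d => //.
move=> q ph lam L qd [h [N [f [l [/andP[h0 hq] NhT fl [phE lamE LE]]]]]] t tT.
have [tN t1 t2] := grid_index h N t h0 NhT tT.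
rewrite phE; set k := Num.truncn _ in t1 t2 tN *.
case: (fl) => _ /(_ _ tN) fk _; apply: dP fk => //.
  exact: (grid_itv _ _ _ h0 NhT).
rewrite ler_norml; move: t2; rewrite -natr1 mulrDl mul1r => t2.
apply/andP; split; lra.
Qed.

(** If [L] grows, some single push is positive, and such a push ends outside the open section. *)
Lemma approx_push_boundary q ph lam L : approx q ph lam L ->
  forall a b, 0 <= a -> a <= b -> b <= T -> L a < L b ->
  exists2 s, a < s <= b & ~ S s (ph s).
Proof.
move=> [h [N [f [l [/andP[h0 hq] NhT fl [phE lamE LE]]]]]] a b a0 ab bT.
have kab : (Num.truncn (a / h) <= Num.truncn (b / h))%N.
  by apply: grid_index_le; rewrite ?a0.
have [|_ _ a2] := grid_index h N a h0 NhT; first by rewrite a0 (le_trans ab).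
have [|bN b1 _] := grid_index h N b h0 NhT; first by rewrite (le_trans a0)/=.
rewrite -subr_gt0 !LE big_nat_sub// => Lab.
have [k /andP[ak kb] lk] : exists2 k,
    (Num.truncn (a / h) <= k < Num.truncn (b / h))%N & 0 < l k.
  apply: contrapT => Nk; move: Lab; apply/negP; rewrite -leNgt.
  rewrite big_nat sumr_le0// => k kab'; rewrite leNgt; apply/negP => lk.
  by apply: Nk; exists k.
(* Push number [k] takes effect at the next grid time, which is strictly after [a] and not after
   [b]. *)
exists (k.+1%:R * h).
  apply/andP; split.
    by apply: (lt_le_trans a2); rewrite ler_wpM2r ?ler_nat// ltW.
  by apply: le_trans b1; rewrite ler_wpM2r ?ler_nat// ltW.
have kN : (k < N)%N by rewrite (leq_trans kb).
case: (fl) => _ _ /(_ _ kN)[_ _ /(_ lk)].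
by rewrite phE mulfK ?gt_eqF// natrK.
Qed.

(** Time is cut into pieces of a common length [d], on each of which the total push is at most 1;
    the number of pieces does not depend on the approximation. *)
Lemma approx_push_bound : exists2 d : R, 0 < d & exists B : R,
  forall q ph lam L, q <= d -> approx q ph lam L ->
  forall t, 0 <= t <= T -> 0 <= L t <= B.
Proof.
have [d d0 dP] := approx_push_small _ ltr01; exists d => //.
exists (Num.truncn (T / d)).+1%:R => q ph lam L qd a t tT.
have [_ _ L0] := approx0 _ _ _ _ a.
have [t0 tleT] := andP tT.
apply/andP; split.
  have := approx_le _ _ _ _ a 0 t (lexx _) t0 tleT.
  by rewrite L0 subr0; apply: le_trans; exact: enorm_ge0.
have /andP[_] : (Num.truncn (T / d))%:R <= T / d < (Num.truncn (T / d)).+1%:R.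
  by apply: truncn_itv; rewrite divr_ge0// ltW.
rewrite ltr_pdivrMr// => /ltW /(le_trans tleT).
move: (_.+1) => k; elim: k t {tT} t0 tleT => [|k ih] t t0 tT.
  rewrite mul0r => tle0; suff -> : t = 0 by rewrite L0.
  by apply/eqP; rewrite eq_le tle0.
rewrite -natr1 mulrDl mul1r => tk.
have [td|td] := leP t d.
  have := dP _ _ _ _ qd a 0 t (lexx _) t0 tT.
  by rewrite subr0 L0 subr0 => /(_ td) /le_trans; apply; rewrite lerDr.
have td0 : 0 <= t - d by lra.
have tdt : t - d <= t by lra.
have tdd : t - (t - d) <= d by lra.
have := dP _ _ _ _ qd a (t - d) t td0 tdt tT tdd.
have : L (t - d) <= k%:R by apply: ih => //; lra.
lra.
Qed.

(** * Passage to the limit along an ultrafilter *)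

Lemma approx_limit : exists (F : set_system nat) (q : nat -> R)
    (ph lam : nat -> R -> V) (L : nat -> R -> R) (lam_oo : R -> V)
    (L_oo : R -> R),
  [/\ ProperFilter F, forall m, approx (q m) (ph m) (lam m) (L m),
    forall d : R, 0 < d -> \forall m \near F, q m <= d,
    forall t (e : R), 0 <= t <= T -> 0 < e ->
      \forall m \near F, enorm (lam m t - lam_oo t) < e &
    forall t (e : R), 0 <= t <= T -> 0 < e ->
      \forall m \near F, `|L m t - L_oo t| < e].
Proof.
have [d d0 [B BP]] := approx_push_bound.
pose q m : R := d / m.+1%:R.
have q0 m : 0 < q m by rewrite divr_gt0.
have qd m : q m <= d by rewrite ler_pdivrMr// ler_peMr ?ler1n// ltW.
have /choice[a aP] : forall m, exists a : (R -> V) * (R -> V) * (R -> R),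
    approx (q m) a.1.1 a.1.2 a.2.
  by move=> m; have [ph [lam [L]]] := approx_exists _ (q0 m); exists (ph, lam, L).
(* Times outside [[0, T]] get a default value in [K], so that compactness applies to every index. *)
pose u m t : V * R :=
  if 0 <= t <= T then ((a m).1.2 t, (a m).2 t) else (0, 0).
pose K : set (V * R) := [set x | `|x| <= `|B|] `*` `[- `|B|, `|B|].
have cK : compact K.
  apply: compact_setX; last exact: segment_compact.
  apply: bounded_closed_compact.
    by exists `|B|; split; [exact: num_real|move=> x Bx y /= /le_trans; apply; exact: ltW].
  have := @closed_ball_closed R V 0 (`|B|).
  rewrite (_ : [set x | _] = (Num.norm : V -> R) @^-1` [set x | x <= `|B|])//.
  move=> _; apply: closed_comp; last exact: closed_le.
  by move=> x _; exact: norm_continuous.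
have uK m t : K (u m t).
  rewrite /u; case: ifPn => [tT|_]; last first.
    by split=> /=; rewrite ?normr0// in_itv/= oppr_le0 !normr_ge0.
  have /andP[L0 LB] := BP _ _ _ _ (qd m) (aP m) t tT.
  have BB := ler_norm B.
  split=> /=; last first.
    rewrite in_itv/=; apply/andP; split; last exact: le_trans BB.
    by apply: le_trans L0; rewrite oppr_le0.
  rewrite (le_trans (ler_norm_enorm _))// (le_trans _ BB)// (le_trans _ LB)//.
  case/andP: tT => t0 tT.
  have := approx_le _ _ _ _ (aP m) 0 t (lexx _) t0 tT.
  by have [_ -> ->] := approx0 _ _ _ _ (aP m); rewrite !subr0.
have [F [l [FP ooF lP]]] := pointwise_ultra_limit K u cK uK.
exists F, q, (fun m => (a m).1.1), (fun m => (a m).1.2), (fun m => (a m).2).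
exists (fun t => (l t).1), (fun t => (l t).2); split=> //.
- move=> e e0; apply: ooF; exists (Num.truncn (d / e)) => // m /= km.
  have : d / e < m.+1%:R by rewrite -truncn_le_nat.
  by rewrite ltr_pdivrMr// => /ltW; rewrite /q ler_pdivrMr// mulrC.
- move=> t e tT e0.
  have l1 : (fun m => (u m t).1) @ F --> (l t).1.
    by apply: (cvg_comp _ _ (lP t)); exact: cvg_fst.
  have e1 : \forall x \near (l t).1, enorm (x - (l t).1) < e.
    by apply/nbhs_enormP; exists e.
  apply: (filterS (F := F) _ (l1 _ e1)) => m /=; by rewrite /u tT.
- move=> t e tT e0.
  have l1 : (fun m => (u m t).2) @ F --> (l t).2.
    by apply: (cvg_comp _ _ (lP t)); exact: cvg_snd.
  near=> m; have : `|(u m t).2 - (l t).2| < e by near: m; exact: cvgr_distC_lt.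
  by rewrite /u tT.
Unshelve. all: by end_near. Qed.

Section Limit.
Variables (F : set_system nat) (q : nat -> R) (ph lam : nat -> R -> V).
Variables (L : nat -> R -> R) (lam_oo : R -> V) (L_oo : R -> R).
Hypothesis FP : ProperFilter F.
Hypothesis approx_m : forall m, approx (q m) (ph m) (lam m) (L m).
Hypothesis q_cvg : forall d : R, 0 < d -> \forall m \near F, q m <= d.
Hypothesis lam_cvg : forall t (e : R), 0 <= t <= T -> 0 < e ->
  \forall m \near F, enorm (lam m t - lam_oo t) < e.
Hypothesis L_cvg : forall t (e : R), 0 <= t <= T -> 0 < e ->
  \forall m \near F, `|L m t - L_oo t| < e.

(** The positions were not part of the compactness argument; their limit comes from that of [lam]
    through the approximate decomposition. *)
Lemma ph_cvg t (e : R) : 0 <= t <= T -> 0 < e ->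
  \forall m \near F, enorm (ph m t - (psi t + lam_oo t)) < e.
Proof.
move=> tT e0; have e2 : 0 < e / 2 by rewrite divr_gt0.
have [d d0 dP] := approx_decomposition _ e2.
near=> m.
have -> : ph m t - (psi t + lam_oo t) =
    (ph m t - (psi t + lam m t)) + (lam m t - lam_oo t) by vring.
rewrite (le_lt_trans (ler_enormD _ _))//.
have h1 : enorm (ph m t - (psi t + lam m t)) <= e / 2.
  have qd : q m <= d by near: m; exact: q_cvg.
  exact: (dP _ _ _ _ qd (approx_m m) _ tT).
have h2 : enorm (lam m t - lam_oo t) < e / 2 by near: m; exact: lam_cvg.
lra.
Unshelve. all: by end_near. Qed.

Lemma limit_closure t : 0 <= t <= T -> closure (S t) (psi t + lam_oo t).
Proof.
move=> tT; apply/closure_enormP => e e0; have e2 : 0 < e / 2 by rewrite divr_gt0.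
have [d d0 dP] := approx_in_domain _ e2.
near F => m.
have [|y yS phy] := dP (q m) (ph m) (lam m) (L m) _ (approx_m m) t tT.
  by near: m; exact: q_cvg.
exists y => //; rewrite (le_lt_trans (ler_enorm_dist (ph m t) _ _))// enormB.
have : enorm (ph m t - (psi t + lam_oo t)) < e / 2 by near: m; exact: ph_cvg.
lra.
Unshelve. all: by end_near. Qed.

Lemma limit_0 : lam_oo 0 = 0 /\ L_oo 0 = 0.
Proof.
have T0 : (0 : R) <= 0 <= T by rewrite lexx/= ltW.
split.
  apply: enorm_eq0; apply/eqP; rewrite eq_le enorm_ge0 andbT.
  apply/ler_addgt0Pr => e e0; rewrite add0r -enormN -[- _]add0r.
  near F => m; have [_ <- _] := approx0 _ _ _ _ (approx_m m).
  by apply/ltW; near: m; exact: lam_cvg.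
apply/eqP; rewrite -normr_le0; apply/ler_addgt0Pr => e e0.
rewrite add0r; near F => m; have [_ _ L0] := approx0 _ _ _ _ (approx_m m).
have : `|L m 0 - L_oo 0| < e by near: m; exact: L_cvg.
by rewrite L0 sub0r normrN => /ltW.
Unshelve. all: by end_near. Qed.

Lemma limit_le a b : 0 <= a -> a <= b -> b <= T ->
  enorm (lam_oo b - lam_oo a) <= L_oo b - L_oo a.
Proof.
move=> a0 ab bT; apply/ler_addgt0Pr => e e0.
have e4 : 0 < e / 4 by rewrite divr_gt0.
have aT : 0 <= a <= T by rewrite a0 (le_trans ab).
have bT' : 0 <= b <= T by rewrite (le_trans a0).
near F => m.
have ha : enorm (lam m a - lam_oo a) < e / 4 by near: m; exact: lam_cvg.
have hb : enorm (lam m b - lam_oo b) < e / 4 by near: m; exact: lam_cvg.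
have La : `|L m a - L_oo a| < e / 4 by near: m; exact: L_cvg.
have Lb : `|L m b - L_oo b| < e / 4 by near: m; exact: L_cvg.
have := approx_le _ _ _ _ (approx_m m) a b a0 ab bT.
have -> : lam_oo b - lam_oo a =
    (lam m b - lam m a) + ((lam m a - lam_oo a) - (lam m b - lam_oo b)) by vring.
have := ler_enormD (lam m b - lam m a) ((lam m a - lam_oo a) - (lam m b - lam_oo b)).
have := ler_enormD (lam m a - lam_oo a) (- (lam m b - lam_oo b)).
rewrite enormN; move: La Lb; rewrite !ltr_norml => /andP[? ?] /andP[? ?]; lra.
Unshelve. all: by end_near. Qed.

(** The modulus of the [L m] is independent of [m] once [q m] is small, so the limit of these step
    functions is uniformly continuous. *)
Lemma limit_small (A : R) : 0 < A -> exists2 d : R, 0 < d &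
  forall a b, 0 <= a -> a <= b -> b <= T -> b - a <= d -> L_oo b - L_oo a <= A.
Proof.
move=> A0; have [d d0 dP] := approx_push_small _ A0; exists d => //.
move=> a b a0 ab bT abd; apply/ler_addgt0Pr => e e0.
have e2 : 0 < e / 2 by rewrite divr_gt0.
have aT : 0 <= a <= T by rewrite a0 (le_trans ab).
have bT' : 0 <= b <= T by rewrite (le_trans a0).
near F => m.
have La : `|L m a - L_oo a| < e / 2 by near: m; exact: L_cvg.
have Lb : `|L m b - L_oo b| < e / 2 by near: m; exact: L_cvg.
have qd : q m <= d by near: m; exact: q_cvg.
have := dP _ _ _ _ qd (approx_m m) a b a0 ab bT abd.
move: La Lb; rewrite !ltr_norml => /andP[? ?] /andP[? ?]; lra.
Unshelve. all: by end_near. Qed.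

(** Only the values at [a] and [b] and the position at [a] occur, so pointwise convergence and the
    continuity of [gam] suffice. *)
Lemma limit_dir (e : R) : 0 < e -> exists2 d : R, 0 < d &
  forall a b, 0 <= a -> a <= b -> b <= T -> b - a <= d ->
  enorm (lam_oo b - lam_oo a - (L_oo b - L_oo a) *: gam a (psi a + lam_oo a))
    <= e * (L_oo b - L_oo a).
Proof.
move=> e0; have [d d0 dP] := approx_push_dir _ e0; exists d => //.
move=> a b a0 ab bT abd; apply/ler_addgt0Pr => eps eps0.
have aT : 0 <= a <= T by rewrite a0 (le_trans ab).
have bT' : 0 <= b <= T by rewrite (le_trans a0).
set D := L_oo b - L_oo a.
have D0 : 0 <= D by apply: le_trans (limit_le _ _ a0 ab bT); exact: enorm_ge0.
(* Replacing the discrete quantities by their limits up to [r <= 1] costs at most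
   [r * (2 * e + 6 + D)] in total. *)
have c0 : 0 < 2 * e + 6 + D by lra.
pose r := Num.min 1 (eps / (2 * e + 6 + D)).
have r0 : 0 < r by rewrite lt_min ltr01 divr_gt0.
have r1 : r <= 1 by rewrite ge_min lexx.
have rP : r * (2 * e + 6 + D) <= eps.
  by rewrite -ler_pdivlMr// ge_min lexx orbT.
clearbody r.
have [dg dg0 dgP] := gam_unif _ r0.
near F => m.
have ha : enorm (lam m a - lam_oo a) < r by near: m; exact: lam_cvg.
have hb : enorm (lam m b - lam_oo b) < r by near: m; exact: lam_cvg.
have La : `|L m a - L_oo a| < r by near: m; exact: L_cvg.
have Lb : `|L m b - L_oo b| < r by near: m; exact: L_cvg.
have pa : enorm (ph m a - (psi a + lam_oo a)) < dg by near: m; exact: ph_cvg.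
have qd : q m <= d by near: m; exact: q_cvg.
have := dP _ _ _ _ qd (approx_m m) a b a0 ab bT abd.
set gm := gam a _; set g := gam a _; set Dm := L m b - L m a => X.
have gg : enorm (gm - g) <= r.
  apply: dgP => //.
  - exact: (approx_enorm _ _ _ _ (approx_m m) _ aT).
  - exact: (bounded_S _ _ aT (limit_closure _ aT)).
  - by rewrite subrr normr0 ltW.
  - exact: ltW.
have g1 : enorm g = 1 by exact: enorm_gam.
have -> : lam_oo b - lam_oo a - D *: g =
    (lam m b - lam m a - Dm *: gm) + ((lam m a - lam_oo a) - (lam m b - lam_oo b))
    + (Dm *: (gm - g) + (Dm - D) *: g) by vring.
have Dm0 : 0 <= Dm.
  by apply: le_trans (approx_le _ _ _ _ (approx_m m) a b a0 ab bT); exact: enorm_ge0.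
have DmD : `|Dm - D| <= 2 * r.
  rewrite /Dm /D; move: La Lb; rewrite !ltr_norml => /andP[? ?] /andP[? ?].
  rewrite ler_norml; apply/andP; split; lra.
have t1 : enorm ((lam m a - lam_oo a) - (lam m b - lam_oo b)) <= 2 * r.
  rewrite (le_trans (ler_enormD _ _))// enormN; lra.
have t2 : enorm (Dm *: (gm - g) + (Dm - D) *: g) <= Dm * r + 2 * r.
  rewrite (le_trans (ler_enormD _ _))// !enormZ g1 mulr1 ger0_norm//.
  by rewrite lerD// ler_wpM2l.
have DmD' : Dm <= D + 2 * r by move: DmD; rewrite ler_norml => /andP[_]; lra.
apply: (@le_trans _ _ (e * Dm + 2 * r + (Dm * r + 2 * r))).
  rewrite (le_trans (ler_enormD _ _))// lerD// (le_trans (ler_enormD _ _))// lerD//.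
have h1 : e * Dm <= e * (D + 2 * r) by rewrite ler_wpM2l// ltW.
have h2 : Dm * r <= (D + 2) * r by rewrite ler_wpM2r//; lra.
lra.
Unshelve. all: by end_near. Qed.

Hypothesis S_open : forall t x, 0 <= t <= T -> S t x -> exists2 r : R, 0 < r &
  forall s y, 0 <= s <= T -> `|s - t| < r -> enorm (y - x) < r -> S s y.

(** Near [t] the approximate paths stay in the open sections, so by [approx_push_boundary] they
    receive no push there, and the limit [L_oo] is constant. *)
Lemma limit_interior t : 0 <= t <= T -> S t (psi t + lam_oo t) ->
  exists2 r : R, 0 < r & forall a b, 0 <= a -> a <= b -> b <= T ->
    `|a - t| < r -> `|b - t| < r -> L_oo b = L_oo a.
Proof.
move=> tT St; have [r r0 rP] := S_open _ _ tT St.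
(* One quarter each for the decomposition error, the increments of [psi] and [lam m] between [s] and
   [t], and the convergence at [t]; the last is strict. *)
have r4 : 0 < r / 4 by rewrite divr_gt0.
have [dA dA0 dAP] := approx_push_small _ r4.
have [dp dp0 dpP] := psi_unif _ r4.
have [dd dd0 ddP] := approx_decomposition _ r4.
pose c := Num.min r (Num.min dA dp).
have c0 : 0 < c by rewrite !lt_min r0 dA0.
have cr : c <= r by rewrite ge_min lexx.
have cA : c <= dA by rewrite !ge_min lexx orbT.
have cp : c <= dp by rewrite !ge_min lexx !orbT.
clearbody c.
exists c => // a b a0 ab bT; rewrite !ltr_norml => /andP[a1 a2] /andP[b1 b2].
have aT : 0 <= a <= T by rewrite a0 (le_trans ab).
have bT' : 0 <= b <= T by rewrite (le_trans a0).
have /andP[t0 tleT] := tT.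
apply/eqP; rewrite -subr_eq0 -normr_le0; apply/ler_addgt0Pr => e e0.
have e2 : 0 < e / 2 by rewrite divr_gt0.
near F => m.
have La : `|L m a - L_oo a| < e / 2 by near: m; exact: L_cvg.
have Lb : `|L m b - L_oo b| < e / 2 by near: m; exact: L_cvg.
have ht : enorm (lam m t - lam_oo t) < r / 4 by near: m; exact: lam_cvg.
have qA : q m <= dA by near: m; exact: q_cvg.
have qd : q m <= dd by near: m; exact: q_cvg.
suff Lab : ~ L m a < L m b.
  move: La Lb Lab; rewrite !ltr_norml => /andP[? ?] /andP[? ?] /negP.
  rewrite -leNgt => Lba.
  have := approx_le _ _ _ _ (approx_m m) a b a0 ab bT.
  have := enorm_ge0 (lam m b - lam m a).
  by move=> *; rewrite ler_norml; apply/andP; split; lra.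
move=> /(approx_push_boundary _ _ _ _ (approx_m m) a b a0 ab bT)[s /andP[as_ sb]]; apply.
have sT : 0 <= s <= T by rewrite (le_trans a0 (ltW as_)) (le_trans sb).
have /andP[s0 sleT] := sT.
apply: rP => //.
  by rewrite ltr_norml; apply/andP; split; lra.
have -> : ph m s - (psi t + lam_oo t) = (ph m s - (psi s + lam m s))
    + (psi s - psi t) + (lam m s - lam m t) + (lam m t - lam_oo t) by vring.
have h1 := ddP _ _ _ _ qd (approx_m m) s sT.
have h2 : enorm (psi s - psi t) <= r / 4.
  by apply: dpP => //; rewrite ler_norml; apply/andP; split; lra.
have h3 : enorm (lam m s - lam m t) <= r / 4.
  have [st|/ltW ts] := leP s t.
    rewrite enormB (le_trans (approx_le _ _ _ _ (approx_m m) _ _ s0 st tleT))//.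
    by apply: (dAP _ _ _ _ qA (approx_m m) _ _ s0 st tleT); lra.
  rewrite (le_trans (approx_le _ _ _ _ (approx_m m) _ _ t0 ts sleT))//.
  by apply: (dAP _ _ _ _ qA (approx_m m) _ _ t0 ts sleT); lra.
have := ler_enormD (ph m s - (psi s + lam m s)
    + (psi s - psi t) + (lam m s - lam m t)) (lam m t - lam_oo t).
have := ler_enormD (ph m s - (psi s + lam m s) + (psi s - psi t)) (lam m s - lam m t).
have := ler_enormD (ph m s - (psi s + lam m s)) (psi s - psi t).
lra.
Unshelve. all: by end_near. Qed.

End Limit.

(** The discrete scheme is left behind here: the rest uses only these properties of [lam] and
    [L]. *)
Lemma reflection_limit :
  (forall t x, 0 <= t <= T -> S t x -> exists2 r : R, 0 < r &
    forall s y, 0 <= s <= T -> `|s - t| < r -> enorm (y - x) < r -> S s y) ->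
  exists (lam : R -> V) (L : R -> R),
  [/\ lam 0 = 0 /\ L 0 = 0,
    forall t, 0 <= t <= T -> closure (S t) (psi t + lam t),
    forall a b, 0 <= a -> a <= b -> b <= T -> enorm (lam b - lam a) <= L b - L a,
    forall A : R, 0 < A -> exists2 d : R, 0 < d &
      forall a b, 0 <= a -> a <= b -> b <= T -> b - a <= d -> L b - L a <= A &
    (forall e : R, 0 < e -> exists2 d : R, 0 < d &
      forall a b, 0 <= a -> a <= b -> b <= T -> b - a <= d ->
      enorm (lam b - lam a - (L b - L a) *: gam a (psi a + lam a))
        <= e * (L b - L a)) /\
    (forall t, 0 <= t <= T -> S t (psi t + lam t) -> exists2 r : R, 0 < r &
      forall a b, 0 <= a -> a <= b -> b <= T ->
      `|a - t| < r -> `|b - t| < r -> L b = L a)].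
Proof.
move=> S_open.
have [F [q [ph [lam [L [lam_oo [L_oo [FP am qc lc Lc]]]]]]]] := approx_limit.
exists lam_oo, L_oo; split.
- exact: (limit_0 F q ph lam L).
- exact: (limit_closure F q ph lam L).
- exact: (limit_le F q ph lam L).
- exact: (limit_small F q ph lam L).
- split; first exact: (limit_dir F q ph lam L).
  exact: (limit_interior F q ph lam L).
Qed.

End Reflection.

(** * Stieltjes measures, local null sets, and induction over short intervals *)

Lemma cumulative_measure {R : realType} (F : cumulative R R) :
  exists mu : {measure set R -> \bar R},
    forall a b, a <= b -> mu `]a, b]%classic = (F b - F a)%:E.
Proof.
pose m : set R -> \bar R := lebesgue_stieltjes_measure F.
have m0 : m set0 = 0%E by exact: measure0.
have m_ge0 A : (0 <= m A)%E by exact: measure_ge0.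
have m_add : semi_sigma_additive m.
  exact: (@measure_semi_sigma_additive _ _ _ (lebesgue_stieltjes_measure F)).
pose mu : {measure set R -> \bar R} := HB.pack m
  (isMeasure.Build _ R R m m0 m_ge0 m_add).
exists mu => a b ab.
transitivity (lebesgue_stieltjes_measure F `]a, b]%classic) => //.
rewrite /lebesgue_stieltjes_measure/= /measure_extension/=.
rewrite measurable_mu_extE; last exact: is_ocitv.
exact: wlength_itv_bnd.
Qed.

Lemma stieltjes_measure {R : realType} (f : R -> R) :
  {homo f : x y / x <= y} -> continuous f ->
  exists mu : {measure set R -> \bar R},
    forall a b, a <= b -> mu `]a, b]%classic = (f b - f a)%:E.
Proof.
move=> ndf cf; exact: (cumulative_measure (HB.pack f
  (isCumulative.Build R _ R f ndf (right_continuousW cf)))).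
Qed.

(** Intervals with rational endpoints are countably many, so the null ones among them form a
    countable cover of [A]. *)
Lemma locally_negligible {R : realType} (mu : {measure set R -> \bar R})
    (A : set R) :
  (forall x, A x -> exists a b : rat,
    ratr a < x <= ratr b /\ mu `]ratr a, ratr b]%classic = 0%E) ->
  mu.-negligible A.
Proof.
move=> locA.
pose E (c : rat * rat) : set R := `]ratr c.1, ratr c.2]%classic.
(* Codes that do not name a null interval contribute the empty set. *)
pose F k := if unpickle k is Some c then
  if `[< mu (E c) = 0%E >] then E c else set0 else set0.
have : mu.-negligible (\bigcup_k F k).
  apply: negligible_bigcup => k; rewrite /F; case: unpickle => [c|].
    case: asboolP => [c0|_]; last exact: negligible_set0.
    by exists (E c); split=> //; exact: measurable_itv.
  exact: negligible_set0.
apply: negligibleS => x /locA[a [b [xab mu0]]].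
exists (pickle (a, b)); first exact: I.
by rewrite /F pickleK asboolT// /E /= in_itv.
Qed.

(** Turns an estimate on intervals of length at most [d] into one on all intervals, by peeling
    pieces of length [d] off the left end finitely often. *)
Lemma step_induction {R : realType} (P : R -> R -> Prop) (d : R) : 0 < d ->
  (forall a, P a a) ->
  (forall a b c, a < b -> b <= c -> b - a <= d -> P b c -> P a c) ->
  forall a b, a <= b -> P a b.
Proof.
move=> d0 P0 PS a b ab.
have : b - a <= (Num.truncn ((b - a) / d)).+1%:R * d.
  rewrite -ler_pdivrMr//; apply: ltW.
  have /andP[_ //] : (Num.truncn ((b - a) / d))%:R <= (b - a) / d <
      (Num.truncn ((b - a) / d)).+1%:R.
  by apply: truncn_itv; rewrite divr_ge0 ?subr_ge0// ltW.
move: (_.+1) => k; elim: k a ab => [|k ih] a ab.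
  rewrite mul0r subr_le0 => ba; suff -> : a = b by [].
  by apply/eqP; rewrite eq_le ab.
rewrite -natr1 mulrDl mul1r => bak.
have [->//|neab] := eqVneq a b.
have {}ab : a < b by rewrite lt_neqAle neab.
have [bad|adb] := leP (b - a) d; first exact: (PS a b b).
apply: (PS a (a + d)); [lra|lra|lra|apply: ih; lra].
Qed.

(** * Total variation and driving measure of a path that moves along [G] at rate [L] *)

Section DirectedVariation.
Context {R : realType} {n : nat}.
Local Notation V := 'rV[R]_n.
Variables (T : R) (lam G : R -> V) (L : R -> R).
Hypothesis T_gt0 : 0 < T.
Hypothesis lam0 : lam 0 = 0.
Hypothesis L0 : L 0 = 0.
Hypothesis lam_le : forall a b, 0 <= a -> a <= b -> b <= T ->
  enorm (lam b - lam a) <= L b - L a.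
Hypothesis L_unif : forall A : R, 0 < A -> exists2 d : R, 0 < d &
  forall a b, 0 <= a -> a <= b -> b <= T -> b - a <= d -> L b - L a <= A.
Hypothesis lam_dir : forall e : R, 0 < e -> exists2 d : R, 0 < d &
  forall a b, 0 <= a -> a <= b -> b <= T -> b - a <= d ->
  enorm (lam b - lam a - (L b - L a) *: G a) <= e * (L b - L a).
Hypothesis G_unif : forall e : R, 0 < e -> exists2 d : R, 0 < d &
  forall s t, 0 <= s <= T -> 0 <= t <= T -> `|s - t| <= d ->
  enorm (G s - G t) <= e.
Hypothesis enorm_G : forall t, 0 <= t <= T -> enorm (G t) = 1.

Lemma L_le a b : 0 <= a -> a <= b -> b <= T -> L a <= L b.
Proof.
move=> a0 ab bT; rewrite -subr_ge0.
by apply: le_trans (lam_le _ _ a0 ab bT); exact: enorm_ge0.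
Qed.

Lemma evariation_cons a b (f : R -> V) x s :
  evariation a b f (x :: s) = enorm (f x - f a) + evariation x b f s.
Proof. by rewrite /evariation/= big_nat_recl. Qed.

Lemma evariation_le a b s : 0 <= a -> b <= T -> itv_partition a b s ->
  evariation a b lam s <= L b - L a.
Proof.
elim: s a => [|x s ih] a a0 bT abs.
  by rewrite (itv_partition_nil abs) subrr /evariation big_geq.
have ax : a <= x by case: abs => /= /andP[/ltW].
have xbs := itv_partition_cons abs.
have xb := itv_partition_le xbs.
rewrite evariation_cons.
have := ih x (le_trans a0 ax) bT xbs.
have := lam_le a x a0 ax (le_trans xb bT); lra.
Qed.

(** Since [G] has unit length, a short increment of [lam] has norm at least [1 - e] times the
    increment of [L]; these bounds add up along a fine partition. *)
Lemma evariation_ge (e : R) b : 0 < e -> b <= T -> forall a, a <= b -> 0 <= a ->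
  exists2 s, itv_partition a b s & (1 - e) * (L b - L a) <= evariation a b lam s.
Proof.
move=> e0 bT a ab; have [d d0 dP] := lam_dir _ e0.
move: a b ab bT; apply: (@step_induction R (fun a b => b <= T -> 0 <= a ->
  exists2 s, itv_partition a b s &
    (1 - e) * (L b - L a) <= evariation a b lam s) d d0).
  move=> a _ _; exists [::]; first by split.
  by rewrite subrr mulr0 /evariation big_geq.
move=> a b c ab bc abd ih cT a0.
have [||s bs sP] := ih; [by []|exact: le_trans (ltW ab)|].
exists (b :: s); first by case: bs => p l; split=> //=; rewrite ab.
rewrite evariation_cons.
have bT := le_trans bc cT.
have := dP a b a0 (ltW ab) bT abd.
have aT : 0 <= a <= T by rewrite a0 (le_trans (ltW ab)).
have := ler_enormD (lam b - lam a) (- (lam b - lam a - (L b - L a) *: G a)).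
have La := L_le _ _ a0 (ltW ab) bT.
rewrite enormN opprB addrCA subrr addr0 enormZ enorm_G// mulr1 ger0_norm ?subr_ge0//.
lra.
Qed.

Lemma eTV_lam t : 0 <= t <= T -> eTV 0 t lam = (L t)%:E.
Proof.
move=> /andP[t0 tT]; have Lt : 0 <= L t by rewrite -L0; exact: L_le.
apply/eqP; rewrite eq_le; apply/andP; split.
  apply: ge_ereal_sup => _ [s st <-]; rewrite lee_fin.
  by have := evariation_le _ _ _ (lexx 0) tT st; rewrite L0 subr0.
apply/lee_addgt0Pr => e e0.
(* With this tolerance the total loss is at most [e]; the added 1 covers [L t = 0]. *)
have d0 : 0 < e / (L t + 1) by rewrite divr_gt0// ltr_wpDl.
have [s st sP] := evariation_ge _ _ d0 tT _ t0 (lexx 0).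
apply: (@le_trans _ _ ((evariation 0 t lam s)%:E + e%:E)%E); last first.
  by apply: leeD => //; apply: ereal_sup_ubound; exists s.
rewrite -EFinD lee_fin; move: sP; rewrite L0 subr0.
have : e / (L t + 1) * L t <= e / (L t + 1) * (L t + 1).
  by rewrite ler_wpM2l ?lerDl// ltW.
rewrite divfK ?gt_eqF ?ltr_wpDl//; lra.
Qed.

(** Local errors small relative to the increments of [L] add up to at most [e * L t] for every [e].
    This identifies [lam] with an integral against the measure of [L] without any differentiation of
    measures. *)
Lemma vanishing_variation (D : R -> R) : D 0 = 0 ->
  (forall e : R, 0 < e -> exists2 d : R, 0 < d &
    forall a b, 0 <= a -> a <= b -> b <= T -> b - a <= d ->
    `|D b - D a| <= e * (L b - L a)) ->
  forall t, 0 <= t <= T -> D t = 0.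
Proof.
move=> D0 Dsmall t /andP[t0 tT].
have Lt : 0 <= L t by rewrite -L0; exact: L_le.
have H e : 0 < e -> forall a b, a <= b -> 0 <= a -> b <= T ->
    `|D b - D a| <= e * (L b - L a).
  move=> e0; have [d d0 dP] := Dsmall _ e0.
  apply: (@step_induction R (fun a b => 0 <= a -> b <= T ->
    `|D b - D a| <= e * (L b - L a)) d d0).
    by move=> a _ _; rewrite !subrr normr0 mulr0.
  move=> a b c ab bc abd ih a0 cT.
  have := ih (le_trans a0 (ltW ab)) cT.
  have := dP a b a0 (ltW ab) (le_trans bc cT) abd.
  have := ler_normD (D c - D b) (D b - D a).
  by rewrite addrA subrK; lra.
apply/eqP; rewrite -normr_le0; apply/ler_addgt0Pr => e e0; rewrite add0r.
have d0 : 0 < e / (L t + 1) by rewrite divr_gt0// ltr_wpDl.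
have := H _ d0 0 t t0 (lexx 0) tT; rewrite D0 L0 !subr0 => /le_trans; apply.
have : e / (L t + 1) * L t <= e / (L t + 1) * (L t + 1).
  by rewrite ler_wpM2l ?lerDl// ltW.
by rewrite divfK ?gt_eqF ?ltr_wpDl.
Qed.

(** Retraction of the line onto [[0, T]]. It extends [L] and [G] by constants, continuously, so the
    Stieltjes measure of the extended [L] charges only []0, T]]. *)
Definition clamp (t : R) : R := Num.max 0 (Num.min t T).

Lemma clamp_itv t : 0 <= clamp t <= T.
Proof.
by rewrite /clamp le_max lexx/= ge_max ge_min lexx orbT andbT ltW.
Qed.

Lemma clamp_id t : 0 <= t <= T -> clamp t = t.
Proof. by move=> /andP[t0 tT]; rewrite /clamp (min_idPl tT) (max_idPr t0). Qed.

Lemma clamp_dist s t : `|clamp s - clamp t| <= `|s - t|.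
Proof.
have h1 := ler_norm (s - t); have h2 := ler_norm (t - s).
rewrite (distrC t s) in h2; move: (`|s - t|) h1 h2 => c h1 h2.
have T0 := T_gt0; rewrite /clamp ler_norml.
case: (leP s T) => sT; case: (leP t T) => tT;
  rewrite ?(max_idPr (ltW T_gt0));
  case: (leP 0 s) => s0; case: (leP 0 t) => t0; apply/andP; split; lra.
Qed.

Lemma clamp_le s t : s <= t -> clamp s <= clamp t.
Proof.
move=> st; have T0 := T_gt0; rewrite /clamp.
case: (leP s T) => sT; case: (leP t T) => tT;
  rewrite ?(max_idPr (ltW T_gt0));
  case: (leP 0 s) => s0; case: (leP 0 t) => t0; lra.
Qed.

Lemma L_clamp_continuous : continuous (L \o clamp).
Proof.
move=> t; apply/cvgrPdist_le => e e0; have [d d0 dP] := L_unif _ e0.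
near=> s => /=.
have /andP[t0 tT] := clamp_itv t; have /andP[s0 sT] := clamp_itv s.
have std : `|clamp t - clamp s| <= d.
  apply: (le_trans (clamp_dist _ _)); apply: ltW.
  by near: s; apply: cvgr_dist_lt => //; exact: cvg_id.
have [ts|/ltW st] := leP (clamp t) (clamp s).
  rewrite distrC ger0_norm ?subr_ge0 ?L_le//; apply: dP => //.
  by rewrite (le_trans _ std)// distrC ler_norm.
rewrite ger0_norm ?subr_ge0 ?L_le//; apply: dP => //.
by rewrite (le_trans _ std)// ler_norm.
Unshelve. all: by end_near. Qed.

Lemma G_clamp_continuous i : continuous (fun s => G (clamp s) 0 i).
Proof.
move=> t; apply/cvgrPdist_le => e e0; have [d d0 dP] := G_unif _ e0.
near=> s => /=.
have std : `|clamp t - clamp s| <= d.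
  apply: (le_trans (clamp_dist _ _)); apply: ltW.
  by near: s; apply: cvgr_dist_lt => //; exact: cvg_id.
have := dP _ _ (clamp_itv t) (clamp_itv s) std; apply: le_trans.
by have := ler_coord_enorm (G (clamp t) - G (clamp s)) i; rewrite !mxE.
Unshelve. all: by end_near. Qed.

(** [mu] is the Stieltjes measure of the clamped [L]. It ignores [U] because [L] is locally constant
    there, and the integral formula compares both sides with [(L b - L a) *: G a] on short
    intervals. *)
Lemma push_measure (U : set R) : open U ->
  (forall t, 0 <= t <= T -> U t -> exists2 r : R, 0 < r &
    forall a b, 0 <= a -> a <= b -> b <= T -> `|a - t| < r -> `|b - t| < r ->
    L b = L a) ->
  exists mu : {measure set R -> \bar R},
    [/\ forall a b, 0 <= a -> a <= b -> b <= T ->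
          mu `]a, b]%classic = (L b - L a)%:E,
      mu (~` `]0%R, T]%classic) = 0%E,
      forall t, 0 <= t <= T -> mu (~` U `&` `]0, t]%classic) = (L t)%:E &
      forall t i, 0 <= t <= T ->
        (lam t 0 i)%:E = (\int[mu]_(s in `]0%R, t]) (G (clamp s) 0 i)%:E)%E].
Proof.
move=> oU Ulocal.
have Lnd : {homo L \o clamp : x y / x <= y}.
  move=> x y xy /=; have /andP[x0 _] := clamp_itv x; have /andP[_ yT] := clamp_itv y.
  by apply: L_le => //; exact: clamp_le.
have [mu muE] := stieltjes_measure _ Lnd L_clamp_continuous.
have muE' a b : 0 <= a -> a <= b -> b <= T ->
    mu `]a, b]%classic = (L b - L a)%:E.
  move=> a0 ab bT; rewrite muE//= !clamp_id//; first by rewrite a0 (le_trans ab).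
  by rewrite (le_trans a0).
have clamp_neg x : x <= 0 -> clamp x = 0.
  move=> x0; rewrite /clamp (min_idPl _) ?(max_idPl x0)//.
  by rewrite (le_trans x0)// ltW.
have clamp_pos x : T <= x -> clamp x = T.
  by move=> x0; rewrite /clamp (min_idPr x0) (max_idPr (ltW T_gt0)).
have neg0 : mu.-negligible (~` `]0%R, T]%classic).
  apply: locally_negligible => x /=; rewrite in_itv/= => /negP.
  rewrite negb_and -leNgt -ltNge => /orP[x0|Tx].
    (* On either side of []0, T]] the clamped [L] is constant, so [x] lies in a rational interval
       without mass; the point 0 may be its right end. *)
    have /rat_in_itvoo[p] : x - 1 < x by lra.
    rewrite in_itv/= => /andP[_ px]; exists p, 0; rewrite raddf0 px x0; split=> //.
    by rewrite muE/= ?clamp_neg// ?subrr// ltW// (lt_le_trans px).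
  have /rat_in_itvoo[p] := Tx; rewrite in_itv/= => /andP[Tp px].
  have /rat_in_itvoo[r] : x < x + 1 by lra.
  rewrite in_itv/= => /andP[xr _]; exists p, r; rewrite px ltW//; split=> //.
  have pr : (ratr p : R) <= ratr r by rewrite ltW// (lt_trans px).
  by rewrite muE//= !clamp_pos ?subrr// ltW// (lt_trans Tp)// (lt_trans px).
have negU : mu.-negligible (U `&` `]0, T]%classic).
  apply: locally_negligible => x [Ux]; rewrite /= in_itv/= => /andP[x0 xT].
  have [|r r0 rP] := Ulocal x _ Ux; first by rewrite ltW.
  have /rat_in_itvoo[p] : x - r < x by lra.
  rewrite in_itv/= => /andP[pr px].
  have /rat_in_itvoo[c] : x < x + r by lra.
  rewrite in_itv/= => /andP[xc cr].
  exists p, c; rewrite px ltW//; split=> //.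
  have pc : (ratr p : R) <= ratr c by rewrite ltW// (lt_trans px).
  (* The rational interval may leave [[0, T]]; as [x] is fixed by [clamp], clamping the endpoints
     does not move them away from [x]. *)
  have xx : clamp x = x by rewrite clamp_id// ltW.
  rewrite muE//=; suff -> : L (clamp (ratr c)) = L (clamp (ratr p)) by rewrite subrr.
  have /andP[p0 _] := clamp_itv (ratr p); have /andP[_ cT] := clamp_itv (ratr c).
  apply: rP => //; first exact: clamp_le.
    rewrite -{1}xx (le_lt_trans (clamp_dist _ _))// ltr_norml.
    by apply/andP; split; lra.
  rewrite -{1}xx (le_lt_trans (clamp_dist _ _))// ltr_norml.
  by apply/andP; split; lra.
have mU : measurable U by exact: measurable_realfun.open_measurable.
exists mu; split=> //.
- apply: measure_negligible => //; exact: measurableC.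
- move=> t /andP[t0 tT].
  (* The part of []0, t]] inside [U] is null, so the whole mass [L t] lies outside [U]. *)
  have : mu `]0, t]%classic =
      (mu (`]0%R, t] `\` U) + mu (`]0%R, t] `&` U))%E by exact: measureDI.
  rewrite muE'// L0 subr0 => ->.
  rewrite [X in (_ + X)%E](_ : _ = 0%E) ?adde0; last first.
    apply: measure_negligible; first exact: measurableI.
    apply: negligibleS negU => x [/=]; rewrite !in_itv/= => /andP[x0 xt] Ux.
    by split=> //; rewrite x0 (le_trans xt).
  by rewrite setDE setIC.
move=> t i tT; have /andP[t0 tleT] := tT.
pose g s := G (clamp s) 0 i.
have g1 s : `|g s| <= 1.
  by rewrite /g -(enorm_G _ (clamp_itv s)); exact: ler_coord_enorm.
have muoo a b : 0 <= a -> a <= b -> b <= T -> (mu `]a, b]%classic < +oo)%E.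
  by move=> a0 ab bT; rewrite muE'// ltry.
have mg : measurable_fun [set: R] g.
  apply: measurable_realfun.continuous_measurable_fun.
  exact: (G_clamp_continuous i).
have ig a b : 0 <= a -> a <= b -> b <= T -> mu.-integrable `]a, b]%classic (EFin \o g).
  move=> a0 ab bT; apply: measurable_bounded_integrable => //.
  - exact: muoo.
  - exact: measurable_funTS.
  - by exists 1; split; [exact: num_real|move=> x x1 s _ /=; apply: le_trans (g1 s) (ltW x1)].
have icst a b c : 0 <= a -> a <= b -> b <= T ->
    mu.-integrable `]a, b]%classic (EFin \o cst c).
  move=> a0 ab bT; apply: measurable_bounded_integrable => //.
  - exact: muoo.
  - by exists `|c|; split; [exact: num_real|move=> x x1 s _ /=; exact: ltW].
(* The defect of the integral formula in coordinate [i]; [vanishing_variation] will show that it is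
   zero. *)
pose D t := lam t 0 i - \int[mu]_(s in `]0, t]) g s.
have D_0 : D 0 = 0.
  by rewrite /D lam0 mxE set_itvoc0 Rintegral_set0 subrr.
suff Dt : D t = 0.
  have -> : lam t 0 i = \int[mu]_(s in `]0, t]) g s by apply/eqP; rewrite -subr_eq0; apply/eqP.
  rewrite /Rintegral fineK//; apply: integrable_fin_num => //.
  exact: (ig 0 t (lexx 0) t0 tleT).
apply: (vanishing_variation D D_0 _ t tT) => e e0.
have e2 : 0 < e / 2 by rewrite divr_gt0.
have [d1 d10 d1P] := lam_dir _ e2.
have [d2 d20 d2P] := G_unif _ e2.
exists (Num.min d1 d2); first by rewrite lt_min d10.
move=> a b a0 ab bT; rewrite le_min => /andP[ab1 ab2].
have b0 := le_trans a0 ab.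
have aT : 0 <= a <= T by rewrite a0 (le_trans ab).
have -> : D b - D a = (lam b - lam a - (L b - L a) *: G a) 0 i
    - (\int[mu]_(s in `]a, b]) g s - (L b - L a) * G a 0 i).
  have split_b : `]0, b]%classic = `]0, a]%classic `|` `]a, b]%classic :> set R.
    by rewrite -itv_bndbnd_setU// bnd_simp.
  rewrite /D split_b Rintegral_setU//; last 2 first.
  - by rewrite -split_b; exact: (ig 0 b).
  - apply/disj_set2P; rewrite -subset0 => x [] /=; rewrite !in_itv/=.
    by move=> /andP[_ xa] /andP[ax _]; have := le_lt_trans xa ax; rewrite ltxx.
  by rewrite !mxE; ring.
have Lab : 0 <= L b - L a by rewrite subr_ge0; exact: L_le.
have h1 : `|(lam b - lam a - (L b - L a) *: G a) 0 i| <= e / 2 * (L b - L a).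
  by apply: le_trans (d1P a b a0 ab bT ab1); exact: ler_coord_enorm.
have h2 : `|\int[mu]_(s in `]a, b]) g s - (L b - L a) * G a 0 i| <= e / 2 * (L b - L a).
  have gG s : `]a, b]%classic s -> `|g s - G a 0 i| <= e / 2.
    rewrite /= in_itv/= => /andP[as_ sb].
    have sT : 0 <= s <= T by rewrite (le_trans a0 (ltW as_)) (le_trans sb).
    have := d2P s a sT aT; rewrite gtr0_norm ?subr_gt0// => h.
    rewrite /g clamp_id//; apply: (@le_trans _ _ (enorm (G s - G a))).
      by have := ler_coord_enorm (G s - G a) i; rewrite !mxE.
    apply: h; apply: le_trans ab2; lra.
  have cstI c : \int[mu]_(_ in `]a, b]) c = c * (L b - L a).
    by rewrite Rintegral_cst// muE'.
  have up : \int[mu]_(s in `]a, b]) g s <= (G a 0 i + e / 2) * (L b - L a).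
    rewrite -cstI; apply: le_Rintegral => //; [exact: ig|exact: icst|].
    by move=> s /gG; rewrite ler_norml => /andP[_]; lra.
  have lo : (G a 0 i - e / 2) * (L b - L a) <= \int[mu]_(s in `]a, b]) g s.
    rewrite -cstI; apply: le_Rintegral => //; [exact: icst|exact: ig|].
    by move=> s /gG; rewrite ler_norml => /andP[]; lra.
  rewrite ler_norml; apply/andP; split; lra.
rewrite (le_trans (ler_normB _ _))//; lra.
Qed.

End DirectedVariation.

(** * Uniform continuity on compact sets *)

(** Around each point half of a radius of continuity serves all nearby points; the near-covering
    form of compactness makes one radius serve all of [K]. *)
Lemma compact_unif_continuous {R : realType} {U W : pseudoMetricType R}
    (K : set U) (F : U -> W) : compact K -> {within K, continuous F} ->
  forall e : R, 0 < e -> exists2 d : R, 0 < d &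
    forall x y, K x -> K y -> ball x d y -> ball (F x) e (F y).
Proof.
move=> /compact_near_coveringP/near_covering_withinP cK.
move=> /subspace_continuousP cF e e0.
pose P (d : R) x := forall y, K y -> ball x d y -> ball (F x) e (F y).
have : \forall d \near 0^'+, K `<=` P d.
  apply: cK => x Kx.
  have e2 : 0 < e / 2 by rewrite divr_gt0.
  have : within K (nbhs x) (F @^-1` ball (F x) (e / 2)).
    by apply: cF => //; exact: nbhsx_ballx.
  rewrite /within/= => /nbhs_ballP[r /= r0 rP].
  have r2 : 0 < r / 2 by rewrite divr_gt0.
  exists (ball x (r / 2), [set d | d < r / 2]) => /=.
    by split; [exact: nbhsx_ballx|exact: nbhs_right_lt].
  move=> [y d] /= [xy dr] Ky z Kz yz.
  apply: (@ball_splitr _ _ (F x)); apply: rP => //.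
    by apply: le_ball xy; lra.
  have -> : r = r / 2 + r / 2 by field.
  apply: ball_triangle xy _; apply: le_ball yz; exact: ltW.
move=> near_d; have [d [d0 dP]] : exists d : R, 0 < d /\ K `<=` P d.
  near (0 : R)^'+ => d; exists d; split; near: d => //.
  exact: nbhs_right_gt.
by exists d => // x y Kx; exact: dP.
Unshelve. all: by end_near. Qed.

(** * Distance to a set, and continuity in time *)

Section DistanceToSet.
Context {R : realType} {n : nat}.
Local Notation V := 'rV[R]_n.
Implicit Types (A : set V) (x y : V).

Lemma dist_to_set_le A x y : A y -> dist_to_set A x <= enorm (x - y).
Proof.
move=> Ay; apply: ge_inf; last by exists y.
by exists 0 => _ [z _ <-]; exact: enorm_ge0.
Qed.

Lemma dist_to_set_lt A x e : A !=set0 -> dist_to_set A x < e ->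
  exists2 y, A y & enorm (x - y) < e.
Proof.
move=> [a Aa] /inf_lt[|_ [y Ay <-] ye]; last by exists y.
by exists (enorm (x - a)); exists a.
Qed.

Lemma dist_to_set_lipschitz A x y : A !=set0 ->
  dist_to_set A x <= enorm (x - y) + dist_to_set A y.
Proof.
move=> A0; rewrite -lerBlDl; apply: lb_le_inf.
  by case: A0 => a Aa; exists (enorm (y - a)); exists a.
move=> _ [z Az <-]; rewrite lerBlDl.
by apply: (le_trans (dist_to_set_le _ _ _ Az)); exact: ler_enorm_dist.
Qed.

Lemma dist_to_set_closure A x : closure A x -> dist_to_set A x <= 0.
Proof.
move=> /closure_enormP clx; apply/ler_addgt0Pr => e e0.
have [y Ay xy] := clx e e0; rewrite add0r.
by apply: (le_trans (dist_to_set_le _ _ _ Ay)); exact: ltW.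
Qed.

End DistanceToSet.

(** On [[0, T]] the function is a constant plus the indefinite integral of an integrable
    function. *)
Lemma H1_nonneg_continuous {R : realType} (T : R) (f : R -> R) : 0 < T ->
  H1_nonneg T f -> {within `[0, T], continuous f}.
Proof.
move=> T0 [_ [g [ig [_ fE]]]].
have := parameterized_integral_continuous (ltW T0) ig.
move=> /subspace_continuousP cI; apply/subspace_continuousP => t tT.
have := cI t tT; set I := parameterized_integral _ _ => cIt.
have fI s : `[0, T]%classic s -> f s = f 0 + I s g.
  rewrite /= in_itv/= => sT; apply: EFin_inj; rewrite fE// EFinD; congr (_ + _)%E.
  rewrite /I /parameterized_integral /Rintegral fineK//.
  apply: integrable_fin_num => //; apply: integrableS ig => //.
  by apply: subset_itvl; rewrite bnd_simp; case/andP: sT.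
change (f @ within `[0, T]%classic (nbhs t) --> f t); rewrite (fI t tT).
apply: (cvg_trans (G := (fun s => f 0 + I s g) @ within `[0, T] (nbhs t))); last first.
  by apply: cvgD cIt; exact: cvg_cst.
apply: near_eq_cvg; near=> s; rewrite [RHS]fI//; near: s.
by rewrite near_withinE; exact: nearW.
Unshelve. all: by end_near. Qed.

Lemma within_continuous_enorm {R : realType} {n : nat} (T : R) (f : R -> 'rV[R]_n) :
  (forall e : R, 0 < e -> exists2 d : R, 0 < d &
    forall s t, 0 <= s <= T -> 0 <= t <= T -> `|s - t| <= d ->
    enorm (f s - f t) <= e) ->
  {within `[0, T], continuous f}.
Proof.
move=> fu; apply/subspace_continuousP => t tT; apply/cvgrPdist_le => e e0.
have [d d0 dP] := fu e e0; rewrite near_withinE.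
near=> s => sT; rewrite (le_trans (ler_norm_enorm _))// dP//.
Unshelve. all: by end_near. Qed.

(** * Time sections of the domain: openness, boundedness and uniform motion *)

Section NoncylindricalDomain.
Context {R : realType} {n : nat}.
Local Notation V := 'rV[R]_n.
Variables (T : R) (Om' : set (R * V)).
Hypothesis T_gt0 : 0 < T.
Hypothesis bounded_Om' : bounded_set Om'.
Hypothesis open_Om' : open Om'.
Let Om := Om' `&` (`[0%R, T] `*` [set: V]).
Let S := tsection Om.
Hypothesis S_neq0 : forall t, 0 <= t <= T -> S t !=set0.

Lemma tsectionE t x : 0 <= t <= T -> S t x <-> Om' (t, x).
Proof.
by move=> tT; split=> [[]|Ot]//; split=> //; split=> //=; rewrite in_itv.
Qed.

Lemma open_enorm_prod t x : Om' (t, x) -> exists2 r : R, 0 < r &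
  forall s y, `|s - t| < r -> enorm (y - x) < r -> Om' (s, y).
Proof.
move=> Otx; have /nbhs_ballP[r /= r0 rP] : nbhs (t, x) Om'.
  by move: open_Om'; rewrite openE => /(_ _ Otx).
exists r => // s y st yx; apply: rP; split=> /=; rewrite -ball_normE/= distrC//.
exact: le_lt_trans (ler_norm_enorm _) yx.
Qed.

Lemma tsection_open_time t x : 0 <= t <= T -> S t x ->
  exists2 r : R, 0 < r &
  forall s y, 0 <= s <= T -> `|s - t| < r -> enorm (y - x) < r -> S s y.
Proof.
move=> tT /(tsectionE _ _ tT)/open_enorm_prod[r r0 rP]; exists r => // s y sT st yx.
by apply/tsectionE => //; exact: rP.
Qed.

Lemma open_tsection t : 0 <= t <= T -> open (S t).
Proof.
move=> tT; rewrite openE => x /(tsection_open_time _ _ tT)[r r0 rP].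
apply/nbhs_enormP; exists r => // y yx; apply: rP => //.
by rewrite subrr normr0.
Qed.

Lemma tsection_bound : exists M : R, forall t x, 0 <= t <= T ->
  closure (S t) x -> enorm x <= M.
Proof.
have [M [_ MP]] := bounded_Om'.
(* Boundedness is available only for numbers above [M], hence [M + 1]; the factor [n] passes from
   the max norm to the Euclidean one. *)
exists (n%:R * (M + 1)) => t x tT /closure_enormP clx.
apply/ler_addgt0Pr => e e0; have [y /(tsectionE _ _ tT) Oy xy] := clx e e0.
have : `|(t, y)| <= M + 1 by apply: MP Oy; rewrite ltrDl.
rewrite prod_normE ge_max/= => /andP[_ yM].
rewrite -[x](subrK y) addrC (le_trans (ler_enormD _ _))//.
rewrite lerD ?(ltW xy)// (le_trans (ler_enorm_norm _))//.
by rewrite ler_wpM2l.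
Qed.

Lemma compact_cylinder (M : R) :
  compact (`[0, T]%classic `*` [set x : V | enorm x <= M]).
Proof.
apply: compact_setX; first exact: segment_compact.
apply: bounded_closed_compact.
  exists M; split; first exact: num_real.
  move=> c Mc x /= xM; rewrite (le_trans (ler_norm_enorm _))//.
  by rewrite (le_trans xM)// ltW.
move=> x /closure_enormP clx; rewrite /=; apply/ler_addgt0Pr => e e0.
have [y /= yM xy] := clx e e0.
rewrite -[x](subrK y) (le_trans (ler_enormD _ _))// addrC.
by rewrite lerD// ltW.
Qed.

Lemma cylinder_unif_continuous {k : nat} (M : R) (F : R -> V -> 'rV[R]_k) :
  {within `[0, T]%classic `*` [set: V], continuous (fun p => F p.1 p.2)} ->
  forall e : R, 0 < e -> exists2 d : R, 0 < d &
    forall (s t : R) (x y : V), 0 <= s <= T -> 0 <= t <= T ->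
    enorm x <= M -> enorm y <= M -> `|s - t| <= d -> enorm (x - y) <= d ->
    enorm (F s x - F t y) <= e.
Proof.
move=> cF e e0.
have cF' : {within `[0, T]%classic `*` [set x : V | enorm x <= M],
    continuous (fun p => F p.1 p.2)}.
  by apply: continuous_subspaceW cF => -[s x] [].
(* The divisor pays for passing from max-norm balls to the Euclidean norm, also when [k = 0]. *)
have e1 : 0 < e / k.+1%:R by rewrite divr_gt0.
have [d d0 dP] := compact_unif_continuous _ _ (compact_cylinder M) cF' _ e1.
exists (d / 2); first by rewrite divr_gt0.
move=> s t x y sT tT xM yM st xy.
have dd : d / 2 < d by lra.
have : ball (F s x) (e / k.+1%:R) (F t y).
  apply: (dP (s, x) (t, y)); try by split=> //=; rewrite in_itv.
  split; rewrite /= -ball_normE/=; first exact: le_lt_trans st dd.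
  by apply: le_lt_trans dd; apply: le_trans xy; exact: ler_norm_enorm.
rewrite -ball_normE/= => H.
rewrite (le_trans (ler_enorm_norm _))//; move: H; rewrite ltr_pdivlMr// mulrC => /ltW.
by apply: le_trans; rewrite ler_wpM2r// ler_nat.
Qed.

Hypothesis dist_H1 : forall x, H1_nonneg T (fun t => dist_to_set (S t) x).

(** The distance is continuous in time for a fixed point and 1-Lipschitz in the point at each time,
    which gives joint continuity. *)
Lemma dist_to_section_continuous (M : R) :
  {within `[0, T]%classic `*` [set x : V | enorm x <= M],
    continuous (fun p : R * V => dist_to_set (S p.1) p.2)}.
Proof.
apply/subspace_continuousP => -[t x] [/= tT xM].
apply/cvgrPdist_lt => e e0; rewrite near_withinE.
have e2 : 0 < e / 2 by rewrite divr_gt0.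
have := H1_nonneg_continuous _ _ T_gt0 (dist_H1 x).
move=> /subspace_continuousP/(_ t tT)/cvgrPdist_lt/(_ _ e2).
rewrite near_withinE => /nbhs_ballP[r /= r0 rP].
have : \forall y \near x, enorm (y - x) < e / 2.
  by apply/nbhs_enormP; exists (e / 2).
move=> /nbhs_ballP[r' /= r'0 rP'].
exists (ball t r, ball x r') => /=; first by split; exact: nbhsx_ballx.
move=> [s y] /= [st xy] [/= sT yM].
have h1 := rP _ st sT; have h2 : enorm (y - x) < e / 2 := rP' _ xy.
have s0 : S s !=set0 by apply: S_neq0; move: sT; rewrite in_itv.
have h3 := dist_to_set_lipschitz _ x y s0.
have h4 := dist_to_set_lipschitz _ y x s0.
rewrite enormB in h3.
move: h1; rewrite !ltr_norml => /andP[? ?]; apply/andP; split; lra.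
Qed.

(** The distance to the section vanishes at [x] at time [s]; by uniform continuity on a compact
    cylinder it is below [e] at time [t]. *)
Lemma tsection_unif (e : R) : 0 < e -> exists2 d : R, 0 < d &
  forall (s t : R) (x : V), 0 <= s <= T -> 0 <= t <= T -> `|s - t| <= d ->
  closure (S s) x -> exists2 y, S t y & enorm (x - y) < e.
Proof.
move=> e0; have [M MP] := tsection_bound.
have [d d0 dP] := compact_unif_continuous _ _ (compact_cylinder M)
  (dist_to_section_continuous M) _ e0.
exists (d / 2); first by rewrite divr_gt0.
move=> s t x sT tT st clx; apply: dist_to_set_lt; first exact: S_neq0.
have xM := MP s x sT clx.
have : ball (dist_to_set (S s) x) e (dist_to_set (S t) x).
  apply: (dP (s, x) (t, x)); try by split=> //=; rewrite in_itv.
  split; last exact: ballxx.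
  by rewrite /= -ball_normE/= (le_lt_trans st)//; lra.
rewrite -ball_normE/= => H.
have := dist_to_set_closure _ _ clx.
by move: H; rewrite ltr_norml => /andP[? ?]; lra.
Qed.

End NoncylindricalDomain.

(** * Assembly of the Skorohod solution from the limit path and its measure *)

Theorem theorem4p5 (R : realType) (n : nat) (T : R)
    (Om' : set (R * 'rV[R]_n)) (gam : R -> 'rV[R]_n -> 'rV[R]_n) (rho : R)
    (psi : R -> 'rV[R]_n) :
  (1 <= n)%N -> 0 < T ->
  (bounded_set Om') -> open Om' -> connected Om' ->
  let Om := Om' `&` (`[0%R, T] `*` [set: 'rV[R]_n]) in
  (forall t, 0 <= t <= T ->
     (tsection Om t !=set0) /\ (bounded_set (tsection Om t)) /\
     connected (tsection Om t)) ->
  C12 T gam ->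
  (forall t x, 0 <= t <= T -> enorm (gam t x) = 1) ->
  0 < rho < 1 ->
  (forall t x, 0 <= t <= T -> boundary (tsection Om t) x ->
     forall zeta, 0 <= zeta <= rho ->
       eball (x - zeta *: gam t x) (zeta * rho) `<=` ~` tsection Om t) ->
  (forall x, H1_nonneg T (fun t => dist_to_set (tsection Om t) x)) ->
  {within `[0%R, T], continuous psi} ->
  closure (tsection Om 0) (psi 0) ->
  exists phi lam : R -> 'rV[R]_n, Skorohod_solution T Om gam psi phi lam.
Proof.
move=> _ T0 bOm oOm _ Om secOm C12gam gam1 /andP[rho0 rho1] cone dH1 cpsi psi0.
pose S := tsection Om.
have S0 t : 0 <= t <= T -> S t !=set0 by move=> /secOm[].
have oS := open_tsection T Om' oOm.
have [M MP] := tsection_bound T Om' bOm.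
have Sunif := tsection_unif T Om' T0 bOm S0 dH1.
have [_ [_ [_ [cgam _]]]] := C12gam.
have gam_unif := cylinder_unif_continuous T M gam cgam.
have psi_unif (e : R) : 0 < e -> exists2 d : R, 0 < d &
    forall s t, 0 <= s <= T -> 0 <= t <= T -> `|s - t| <= d ->
    enorm (psi s - psi t) <= e.
  move=> e0; have e1 : 0 < e / n.+1%:R by rewrite divr_gt0.
  have [d d0 dP] := compact_unif_continuous _ _ (@segment_compact _ 0 T) cpsi _ e1.
  exists (d / 2); first by rewrite divr_gt0.
  move=> s t sT tT st.
  have := dP s t; rewrite -!ball_normE/= !in_itv/= => /(_ sT tT) H.
  rewrite (le_trans (ler_enorm_norm _))//.
  have : `|psi s - psi t| < e / n.+1%:R by apply: H; apply: le_lt_trans st _; lra.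
  rewrite ltr_pdivlMr// mulrC => /ltW.
  by apply: le_trans; rewrite ler_wpM2r// ler_nat.
have cone' t x : 0 <= t <= T -> closure (S t) x -> ~ S t x ->
    forall z : R, 0 <= z <= rho -> forall y,
    enorm (y - (x - z *: gam t x)) < z * rho -> ~ S t y.
  move=> tT clx Nx z zr y yx; apply: (cone t x tT _ z zr y yx).
  by apply/boundaryP => //; exact: oS.
have [lam [L [[lam0 L0] lamcl lam_le L_small [lam_dir lam_int]]]] :=
  reflection_limit T rho M S gam psi T0 rho0 (ltW rho1) oS MP gam1 cone'
    Sunif gam_unif psi_unif psi0 (tsection_open_time T Om' oOm).
pose phi t := psi t + lam t.
have lam_unif (e : R) : 0 < e -> exists2 d : R, 0 < d &
    forall s t, 0 <= s <= T -> 0 <= t <= T -> `|s - t| <= d ->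
    enorm (lam s - lam t) <= e.
  move=> e0; have [d d0 dP] := L_small _ e0; exists d => //.
  move=> s t /andP[s0 sT] /andP[t0 tT]; have [st|/ltW ts] := leP s t.
    rewrite distrC ger0_norm ?subr_ge0// enormB => std.
    by rewrite (le_trans (lam_le _ _ s0 st tT))// dP.
  rewrite ger0_norm ?subr_ge0// => std.
  by rewrite (le_trans (lam_le _ _ t0 ts sT))// dP.
have phi_unif (e : R) : 0 < e -> exists2 d : R, 0 < d &
    forall s t, 0 <= s <= T -> 0 <= t <= T -> `|s - t| <= d ->
    enorm (phi s - phi t) <= e.
  move=> e0; have e2 : 0 < e / 2 by rewrite divr_gt0.
  have [d1 d10 d1P] := psi_unif _ e2; have [d2 d20 d2P] := lam_unif _ e2.
  exists (Num.min d1 d2); first by rewrite lt_min d10.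
  move=> s t sT tT; rewrite le_min => /andP[st1 st2].
  rewrite /phi opprD addrACA (le_trans (ler_enormD _ _))//.
  have := d1P s t sT tT st1; have := d2P s t sT tT st2; lra.
pose G t := gam t (phi t).
have phiM t : 0 <= t <= T -> enorm (phi t) <= M.
  by move=> tT; apply: MP tT (lamcl t tT).
have G_unif (e : R) : 0 < e -> exists2 d : R, 0 < d &
    forall s t, 0 <= s <= T -> 0 <= t <= T -> `|s - t| <= d ->
    enorm (G s - G t) <= e.
  move=> e0; have [d1 d10 d1P] := gam_unif _ e0; have [d2 d20 d2P] := phi_unif _ d10.
  exists (Num.min d1 d2); first by rewrite lt_min d10.
  move=> s t sT tT; rewrite le_min => /andP[st1 st2].
  by apply: d1P => //; [exact: phiM|exact: phiM|exact: d2P].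
have G1 t : 0 <= t <= T -> enorm (G t) = 1 by exact: gam1.
(* On [[0, T]] these are the times when [phi] is in the open section; using [Om'] and the clamped
   path makes [U] open in the whole line. *)
pose U := [set s | Om' (s, phi (clamp T s))].
have UE t : 0 <= t <= T -> U t <-> S t (phi t).
  by move=> tT; rewrite /U/= clamp_id//; split => /(tsectionE T Om' t _ tT).
have oU : open U.
  rewrite openE => s /(open_enorm_prod Om' oOm)[r r0 rP].
  have r2 : 0 < r / 2 by rewrite divr_gt0.
  have [d d0 dP] := phi_unif _ r2.
  apply/nbhs_ballP; exists (Num.min r d) => /=; first by rewrite lt_min r0.
  move=> u; rewrite -ball_normE/= distrC lt_min => /andP[ur ud]; apply: rP => //.
  apply: (@le_lt_trans _ _ (r / 2)); last lra.
  apply: dP; [exact: clamp_itv|exact: clamp_itv|].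
  by rewrite (le_trans (clamp_dist _ T0 _ _))// ltW.
have [mu [muE mu_out muU mu_lam]] :=
  push_measure T lam G L T0 lam0 L0 lam_le L_small lam_dir G_unif G1 U oU
    (fun t tT Ut => lam_int t tT ((UE t tT).1 Ut)).
have TV := eTV_lam T lam G L L0 lam_le lam_dir G1.
exists phi, lam; split; first exact: within_continuous_enorm.
split; first exact: within_continuous_enorm.
split=> //; split; first by rewrite /phi lam0 addr0.
split=> //; split; first by rewrite TV ?ltry// lexx ltW.
exists mu; split.
  move=> a b a0 ab bT; rewrite muE// !TV//; first by rewrite a0 (le_trans ab).
  by rewrite (le_trans a0).
split=> //; split.
  (* Since [phi] stays in the closures of open sections, it is on the boundary exactly at the times
     outside [U], and these carry the whole mass. *)
  move=> t /andP[t0 tT]; rewrite TV ?t0// -muU ?t0//.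
  rewrite -integral_indic//; last first.
    by apply: measurableC; exact: measurable_realfun.open_measurable.
  apply: eq_integral => s; rewrite inE/= in_itv/= => /andP[s0 st].
  have sT : 0 <= s <= T by rewrite ltW//= (le_trans st).
  congr (_%:E); rewrite !indicE; congr (_%:R); congr (nat_of_bool _).
  apply/idP/idP; rewrite !inE/=.
    move=> NU; apply/boundaryP; first exact: oS.
    by split; [exact: lamcl|move/(UE s sT)].
  by move=> /(boundaryP _ _ (oS s sT))[_ NS] /(UE s sT).
(* Clamping makes this direction continuous on the line, hence measurable; it equals [gam s (phi s)]
   on []0, T]], off which [mu] vanishes. *)
exists (fun s => G (clamp T s)); split.
  move=> i; apply: measurable_realfun.continuous_measurable_fun.
  exact: G_clamp_continuous.
split.
  apply: (@negligibleS _ _ _ mu (~` `]0%R, T]%classic)); last first.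
    by exists (~` `]0%R, T]%classic); split=> //; exact: measurableC.
  move=> s; apply: contra_not; rewrite /= in_itv/= => /andP[s0 sT].
  by rewrite clamp_id// ltW.
by move=> t i tT; rewrite mu_lam.
Qed.
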